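(* Let $f:\mathbb{R}^m\times\mathbb{R}\to\mathbb{R}^m$ be a $C^1$ map such that $f(\cdot,0)$ is bijective and has a compact, global, uniformly hyperbolic attractor $\Lambda\subset\mathbb{R}^m$ (as defined in the context). Let $J:\mathbb{R}^m\times\mathbb{R}\to\mathbb{R}$ be a $C^1$ function whose infinite time average $$\langle J\rangle(s) := \lim_{n\to\infty}\frac1n\sum_{i=1}^n J(f^{(i)}(u_0,s),s)$$ exists and is independent of the initial state $u_0\in\mathbb{R}^m$, for every $s\in\mathbb{R}$. Let $\{u_i, i\in\mathbb{Z}\}\subset\Lambda$ be a sequence satisfying $u_{i+1}=f(u_i,0)$ for all $i\in\mathbb{Z}$. For each $n\ge1$ let $v_1^{\{n\}},\ldots,v_n^{\{n\}}\in\mathbb{R}^m$ be the solution of the constrained least squares problem $$\min\ \frac12\sum_{i=1}^n (v_i^{\{n\}})^T v_i^{\{n\}}\quad\text{subject to}\quad v_{i+1}^{\{n\}}=(Df(u_i,0))\,v_i^{\{n\}}+(\partial_s f(u_i,0)),\quad i=1,\ldots,n-1.$$ Then the derivative $\frac{d\langle J\rangle}{ds}\big|_{s=0}$ exists, the following limit exists, and $$\lim_{n\to\infty}\frac1n\sum_{i=1}^n\Big((DJ(u_i,0))\,v_i^{\{n\}}+(\partial_sJ(u_i,0))\Big)=\frac{d\langle J\rangle}{ds}\bigg|_{s=0}.$$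
   Context: Notation: $\|\cdot\|$ is the Euclidean norm on $\mathbb{R}^m$ (and the induced operator norm). $Df(u,s)$ and $DJ(u,s)$ denote the derivatives with respect to $u$ (an $m\times m$ matrix and a $1\times m$ matrix), and $\partial_s f(u,s)$, $\partial_s J(u,s)$ the partial derivatives with respect to $s$. Iterates: $f^{(0)}(u,s)=u$, $f^{(i+1)}(u,s)=f^{(i)}(f(u,s),s)$; at $s=0$ this is used for all $i\in\mathbb{Z}$, negative $i$ denoting iterates of the inverse of $f(\cdot,0)$. $Df^{(i)}(u,s)$ is the derivative of $f^{(i)}(\cdot,s)$ at $u$. A compact, global, uniformly hyperbolic attractor (at $s=0$) is a compact set $\Lambda\subset\mathbb{R}^m$ with $f(\Lambda,0)=\Lambda$ and with $Df(u,0)$ invertible for every $u\in\Lambda$ (so that $Df^{(i)}(u,0)$ makes sense for all $i\in\mathbb{Z}$, $u\in\Lambda$), such that: (1) for all $u_0\in\mathbb{R}^m$, $\mathrm{dist}(\Lambda,f^{(n)}(u_0,0))\to0$ as $n\to\infty$ (Euclidean distance); (2) there are $C\in(0,\infty)$ and $\lambda\in(0,1)$ such that for all $u\in\Lambda$ the sets $V^+(u)=\{v\in\mathbb{R}^m:\|(Df^{(i)}(u,0))v\|\le C\lambda^{-i}\|v\|\ \forall i<0\}$ (unstable subspace) and $V^-(u)=\{v\in\mathbb{R}^m:\|(Df^{(i)}(u,0))v\|\le C\lambda^{i}\|v\|\ \forall i>0\}$ (stable subspace) are linear subspaces with $\mathbb{R}^m=V^+(u)\oplus V^-(u)$, and both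 depend continuously on $u\in\Lambda$. These subspaces are invariant under the differential: for $u\in\Lambda$, $u'=f(u,0)$, $v'=(Df(u,0))v$, one has $v\in V^\pm(u)\iff v'\in V^\pm(u')$; this is taken as part of the setting. *)

(* Defs.v *)
From HB Require Import structures.
From mathcomp Require Import all_boot all_order all_algebra.
From mathcomp Require Import all_classical all_reals all_analysis.

Set Implicit Arguments.
Unset Strict Implicit.
Unset Printing Implicit Defensive.

Import Order.TTheory GRing.Theory Num.Theory.
Import numFieldNormedType.Exports.

Local Open Scope classical_set_scope.
Local Open Scope ring_scope.

(* R^m is 'cV[R]_m. The norm `|_| of the library on 'cV[R]_m is the sup norm;
   it induces the usual topology and notion of differentiability, and the
   Euclidean norm is enorm below. *)

Section Euclidean.
Context {R : realType} {m : nat}.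
Implicit Types (u v : 'cV[R]_m).

Definition dotp u v : R := (u^T *m v) ord0 ord0.

Definition enorm v : R := Num.sqrt (dotp v v).

(* Extended-real valued, so that the distance to set0 is +oo. *)
Definition edistance (A : set 'cV[R]_m) u : \bar R :=
  ereal_inf [set (enorm (u - y))%:E | y in A].

Definition orthogonal_projector (P : 'M[R]_m) (V : {vspace 'cV[R]_m}) : Prop :=
  forall v, P *m v \in V /\ forall y, y \in V -> dotp (v - P *m v) y = 0.

(* Continuity for the usual topology of the Grassmannian, that is, continuity
   of the (unique) orthogonal projector onto the subspace. *)
Definition continuous_subspace (A : set 'cV[R]_m)
    (V : 'cV[R]_m -> {vspace 'cV[R]_m}) : Prop :=
  exists P : 'cV[R]_m -> 'M[R]_m,
    {within A, continuous P} /\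
    forall u, A u -> orthogonal_projector (P u) (V u).

End Euclidean.

(* The second condition is the continuity of z |-> 'd g z for the operator
   norm. *)
Definition C1 {R : realType} {V W : normedModType R} (g : V -> W) : Prop :=
  (forall z, differentiable g z) /\
  forall z (e : R), 0 < e ->
    \forall z' \near z, forall h, `|'d g z' h - 'd g z h| <= e * `|h|.

Section Dynamics.
Context {R : realType} {m : nat}.
Implicit Types (F : 'cV[R]_m -> 'cV[R]_m) (L : set 'cV[R]_m).

(* For a bijective F, pinv is the inverse of F; Negz n is - (n + 1). *)
Definition ziter F (i : int) : 'cV[R]_m -> 'cV[R]_m :=
  match i with
  | Posz n => iter n F
  | Negz n => iter n.+1 (pinv [set: 'cV[R]_m] F)
  end.

Definition unstable F (C lambda : R) (u : 'cV[R]_m) : set 'cV[R]_m :=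
  [set v | forall i : int, i < 0 ->
     enorm ('d (ziter F i) u v) <= C * lambda ^ (- i) * enorm v].

Definition stable F (C lambda : R) (u : 'cV[R]_m) : set 'cV[R]_m :=
  [set v | forall i : int, 0 < i ->
     enorm ('d (ziter F i) u v) <= C * lambda ^ i * enorm v].

Definition hyperbolic_splitting F L (C lambda : R) : Prop :=
  exists Vu Vs : 'cV[R]_m -> {vspace 'cV[R]_m},
    [/\ forall u, L u ->
          [/\ [set` Vu u] = unstable F C lambda u,
              [set` Vs u] = stable F C lambda u,
              (Vu u + Vs u)%VS = fullv & (Vu u :&: Vs u)%VS = 0%VS],
        continuous_subspace L Vu & continuous_subspace L Vs].

Definition invariant_splitting F L (C lambda : R) : Prop :=
  forall u v, L u ->
    (unstable F C lambda u v <-> unstable F C lambda (F u) ('d F u v)) /\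
    (stable F C lambda u v <-> stable F C lambda (F u) ('d F u v)).

Record uniformly_hyperbolic_attractor F L : Prop := UniformlyHyperbolicAttractor {
  attractor_compact : compact L;
  attractor_image : F @` L = L;
  attractor_unit : forall u, L u -> bijective ('d F u);
  attractor_global : forall u0,
    (fun n => edistance L (iter n F u0)) @ \oo --> 0%E;
  attractor_hyperbolic : exists C lambda : R,
    [/\ 0 < C, 0 < lambda < 1, hyperbolic_splitting F L C lambda
      & invariant_splitting F L C lambda]
}.

Definition is_time_average (f : 'cV[R]_m * R -> 'cV[R]_m)
    (J : 'cV[R]_m * R -> R) (s l : R) : Prop :=
  forall u0 : 'cV[R]_m,
    (fun n : nat => n%:R^-1 *
       \sum_(1 <= i < n.+1) J (iter i (fun x => f (x, s)) u0, s)) @ \oo --> l.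

(* Only the values v 1, ..., v n are relevant in the next two definitions. *)
Definition lss_constraint (f : 'cV[R]_m * R -> 'cV[R]_m)
    (u : int -> 'cV[R]_m) (n : nat) (v : nat -> 'cV[R]_m) : Prop :=
  forall i : nat, (1 <= i < n)%N ->
    v i.+1 = 'd (fun x => f (x, 0)) (u i) (v i)
             + (fun s : R => f (u i, s))^`()%classic 0.

Definition lss_solution (f : 'cV[R]_m * R -> 'cV[R]_m)
    (u : int -> 'cV[R]_m) (n : nat) (v : nat -> 'cV[R]_m) : Prop :=
  lss_constraint f u n v /\
  forall w, lss_constraint f u n w ->
    2^-1 * \sum_(1 <= i < n.+1) dotp (v i) (v i)
      <= 2^-1 * \sum_(1 <= i < n.+1) dotp (w i) (w i).

End Dynamics.

(* Main.v *)
Require Import Defs.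
From HB Require Import structures.
From mathcomp Require Import all_boot all_order all_algebra.
From mathcomp Require Import all_classical all_reals all_analysis.
From mathcomp Require Import ring lra.

Set Implicit Arguments.
Unset Strict Implicit.
Unset Printing Implicit Defensive.

Import Order.TTheory GRing.Theory Num.Theory.
Import numFieldNormedType.Exports.

Local Open Scope classical_set_scope.
Local Open Scope ring_scope.

(* No structural stability is needed: the dichotomy along the orbit (u_i), i >= 0,
   suffices. It makes every bounded inhomogeneous linear recursion
   w_{i+1} = A_i w_i + g_i, A_i = Df(u_i, 0), boundedly solvable, and Picard
   iteration extends this to small Lipschitz perturbations. With g_i = d_s f(u_i, 0)
   this gives a bounded tangent solution w, and then, for small s, an orbit x of
   f(., s) with x_i = u_i + s w_i + o(s) uniformly in i. Hence the difference
   quotients of <J> are uniformly close to the finite averages of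
   DJ(u_i, 0) w_i + d_s J(u_i, 0), so these averages are Cauchy and <J> is
   differentiable at 0. For the least squares solutions v, the difference v - w
   solves the homogeneous recursion and is therefore concentrated near the end
   points i = 1, n, where minimality bounds it by O(sqrt n): its average tends
   to 0. *)

(** Joins completeness to the normed module structure of matrices, so that [geometric_cvg] applies
    to sequences of vectors. *)
HB.instance Definition _ (R : realType) (m n : nat) := Complete.on 'M[R]_(m, n).

(** * Geometric convergence and sup-norm estimates for matrices *)

Section NormedModules.
Context {R : realType}.

Lemma cvg_norm_le (V : normedModType R) (x : nat -> V) (l a : V) (K : R) :
  x @ \oo --> l -> (forall n, `|x n - a| <= K) -> `|l - a| <= K.
Proof.
move=> xl xK.
have h : (fun n => `|x n - a|) @ \oo --> `|l - a|.
  by apply: cvg_norm; apply: cvgB => //; exact: cvg_cst.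
by apply: (closed_cvg (fun r => r <= K)) h; [exact: closed_le|exact: nearW].
Qed.

Lemma geometric_sum_le (lam : R) n : 0 <= lam < 1 ->
  \sum_(i < n) lam ^+ i <= (1 - lam)^-1.
Proof.
move=> /andP[l0 l1]; rewrite -[X in _ <= X]mul1r ler_pdivlMr ?subr_gt0//.
rewrite mulrC -opprB mulNr -subrX1 opprB lerBlDr lerDl; exact: exprn_ge0.
Qed.

(** The telescoping series of the increments is dominated by a geometric series. This yields the
    limits of the backward sums, of the Picard iteration and of the Newton iteration below. *)
Lemma geometric_cvg (V : completeNormedModType R) (x : nat -> V) (c lam : R) :
  0 <= lam < 1 -> 0 <= c -> (forall n, `|x n.+1 - x n| <= c * lam ^+ n) ->
  (forall n, `|x n - x 0%N| <= c / (1 - lam)) /\ cvg (x @ \oo).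
Proof.
move=> /andP[l0 l1] c0 hx.
have telE n : x n = x 0%N + series (telescope x) n by exact: eq_sum_telescope.
split=> [n|].
  rewrite telE addrC addKr /series /= big_mkord.
  apply: le_trans (ler_norm_sum _ _ _) _.
  apply: (@le_trans _ _ (\sum_(i < n) c * lam ^+ i)).
    by apply: ler_sum => i _; exact: hx.
  by rewrite -mulr_sumr ler_wpM2l// geometric_sum_le// l0.
suff : cvgn (series (telescope x)).
  move=> h; rewrite (_ : x = (fun n => x 0%N + series (telescope x) n)).
    by apply: is_cvgD => //; exact: is_cvg_cst.
  by apply/funext => n; exact: telE.
apply: normed_cvg; apply: (@series_le_cvg _ _ (geometric c lam)) => //.
- by move=> n; exact: normr_ge0.
- by move=> n; apply: mulr_ge0; [|exact: exprn_ge0].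
- by apply: is_cvg_geometric_series; rewrite ger0_norm.
Qed.

Lemma mx_norm_coord m n (M : 'M[R]_(m, n)) i j : `|M i j| <= `|M|.
Proof.
rewrite [leRHS]/Num.Def.normr /= mx_normrE.
exact: (@le_bigmax _ _ _ _ (fun ij : 'I_m * 'I_n => `|M ij.1 ij.2|) (i, j)).
Qed.

Lemma mx_norm_le m n (M : 'M[R]_(m, n)) (c : R) :
  0 <= c -> (forall i j, `|M i j| <= c) -> `|M| <= c.
Proof.
move=> c0 h; rewrite [leLHS]/Num.Def.normr /= mx_normrE; apply/bigmax_leP; split=> //.
Qed.

Lemma mulmx_norm_le m n p (M : 'M[R]_(m, n)) (N : 'M[R]_(n, p)) :
  `|M *m N| <= n%:R * `|M| * `|N|.
Proof.
apply: mx_norm_le => [|i j]; first by rewrite !mulr_ge0.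
rewrite mxE; apply: le_trans (ler_norm_sum _ _ _) _.
rewrite -mulrA mulr_natl -[X in _ *+ X]card_ord -sumr_const.
by apply: ler_sum => k _; rewrite normrM ler_pM// mx_norm_coord.
Qed.

Lemma mulmx_continuous m n p (M : 'M[R]_(m, n)) :
  continuous (fun N : 'M[R]_(n, p) => M *m N).
Proof.
move=> N; apply/(@cvgrPdist_le _ _ _ (nbhs N)) => e e0.
have k0 : 0 < n%:R * `|M| + 1 by rewrite ltr_wpDl// mulr_ge0.
have e'0 : 0 < e / (n%:R * `|M| + 1) by rewrite divr_gt0.
apply: filterS (nbhsx_ballx N _ e'0) => N'.
rewrite -ball_normE /= => /ltW hN'; rewrite -mulmxBr.
apply: le_trans (mulmx_norm_le _ _) _.
apply: (@le_trans _ _ ((n%:R * `|M| + 1) * `|N - N'|)).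
  by rewrite ler_wpM2r// lerDl.
by rewrite mulrC -ler_pdivlMr.
Qed.

End NormedModules.

(** * Linear recursions with an exponential dichotomy *)

Section Cocycles.
Context {R : realType} {m : nat}.
Implicit Types (A : nat -> 'M[R]_m) (v : 'cV[R]_m).

(** The propagator A_{n+i-1} ... A_i of the recursion x_{i+1} = A_i x_i, from index i to index n +
    i; [icocycle] is the way back when the A_i are invertible. *)
Fixpoint cocycle A n i : 'M[R]_m :=
  if n is n'.+1 then cocycle A n' i.+1 *m A i else 1%:M.

Fixpoint icocycle A n i : 'M[R]_m :=
  if n is n'.+1 then invmx (A i) *m icocycle A n' i.+1 else 1%:M.

Lemma cocycleSr A n i : cocycle A n.+1 i = A (n + i)%N *m cocycle A n i.
Proof.
elim: n i => [|n IH] i /=; first by rewrite mul1mx mulmx1.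
by rewrite -[cocycle A n i.+2 *m _]/(cocycle A n.+1 i.+1) IH mulmxA addnS.
Qed.

Lemma cocycleK A n i : (forall i, A i \in unitmx) ->
  icocycle A n i *m cocycle A n i = 1%:M.
Proof.
move=> uA; elim: n i => [|n IH] i /=; first by rewrite mulmx1.
by rewrite -mulmxA (mulmxA (icocycle _ _ _)) IH mul1mx mulVmx.
Qed.

Lemma icocycleK A n i : (forall i, A i \in unitmx) ->
  cocycle A n i *m icocycle A n i = 1%:M.
Proof. by move=> uA; apply: mulmx1C; exact: cocycleK. Qed.

(* In dich_unstable the inverse cocycle runs from index n + i back to i. *)
Record dichotomy A (Ps Pu : nat -> 'M[R]_m) (c lam : R) : Prop := Dichotomy {
  dich_rate : 0 <= lam < 1;
  dich_unit : forall i, A i \in unitmx;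
  dich_sum : forall i, Ps i + Pu i = 1%:M;
  dich_comm : forall i, A i *m Ps i = Ps i.+1 *m A i;
  dich_stable : forall n i v,
    `|cocycle A n i *m (Ps i *m v)| <= c * lam ^+ n * `|v|;
  dich_unstable : forall n i v,
    `|icocycle A n i *m (Pu (n + i)%N *m v)| <= c * lam ^+ n * `|v|
}.

Section Dichotomy.
Context (A Ps Pu : nat -> 'M[R]_m) (c lam : R).
Hypothesis dich : dichotomy A Ps Pu c lam.
Hypothesis c_ge0 : 0 <= c.

Let l0 : 0 <= lam. Proof. by have /andP[] := dich_rate dich. Qed.
Let l1 : lam < 1. Proof. by have /andP[] := dich_rate dich. Qed.

(** Variation of constants: the stable components of the past inhomogeneities, carried forward from
    index 0. *)
Let stable_part (g : nat -> 'cV[R]_m) n : 'cV[R]_m :=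
  \sum_(j < n) cocycle A (n - j.+1) j.+1 *m (Ps j.+1 *m g j).

Let stable_partS g n : stable_part g n.+1 = A n *m stable_part g n + Ps n.+1 *m g n.
Proof.
rewrite /stable_part big_ord_recr /= subnn mul1mx mulmx_sumr; congr (_ + _).
apply: eq_bigr => j _.
by rewrite subSS -(subnSK (ltn_ord j)) cocycleSr subnK ?ltn_ord ?mulmxA.
Qed.

Let stable_part_le g b : (forall i, `|g i| <= b) ->
  forall n, `|stable_part g n| <= c / (1 - lam) * b.
Proof.
move=> gb n; apply: le_trans (ler_norm_sum _ _ _) _.
have b0 : 0 <= b by apply: le_trans (gb 0%N).
apply: (@le_trans _ _ (\sum_(j < n) c * b * lam ^+ (n - j.+1))).
  apply: ler_sum => j _; apply: le_trans (dich_stable dich _ _ _) _.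
  by rewrite mulrAC ler_wpM2r ?exprn_ge0// ler_wpM2l.
rewrite -mulr_sumr [leRHS]mulrAC ler_wpM2l ?mulr_ge0//.
rewrite (reindex_inj rev_ord_inj) /=.
rewrite (eq_bigr (fun i : 'I_n => lam ^+ i)); last first.
  by move=> i _; rewrite subnSK// subKn// ltnW.
by apply: geometric_sum_le; rewrite l0.
Qed.

(** Unstable components contract when carried backwards, so they are collected from the future: this
    is the sum truncated to the n terms g_i, ..., g_{i+n-1}. *)
Let unstable_sum (g : nat -> 'cV[R]_m) := fix F n i : 'cV[R]_m :=
  if n is n'.+1 then invmx (A i) *m (Pu i.+1 *m g i + F n' i.+1) else 0.

Let unstable_sumB g n i : unstable_sum g n.+1 i - unstable_sum g n i =
  icocycle A n.+1 i *m (Pu (n.+1 + i)%N *m g (n + i)%N).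
Proof.
elim: n i => [|n IH] i; first by rewrite /= addr0 subr0 mulmx1 add0n.
transitivity (invmx (A i) *m (unstable_sum g n.+1 i.+1 - unstable_sum g n i.+1)).
  by rewrite /= -mulmxBr; congr (_ *m _); rewrite opprD addrACA subrr add0r.
by rewrite IH !addnS !addSn [icocycle _ n.+2 _]/= -!mulmxA.
Qed.

(** The bounded solution is the past sum of stable components minus the future sum of unstable ones.
    A geometric series bounds each by c b / (1 - lam), whence the factor 2. *)
Lemma linear_shadowing (g : nat -> 'cV[R]_m) (b : R) :
  (forall i, `|g i| <= b) ->
  exists w : nat -> 'cV[R]_m, (forall i, w i.+1 = A i *m w i + g i) /\
    forall i, `|w i| <= 2 * c / (1 - lam) * b.
Proof.
move=> gb.
have b0 : 0 <= b by apply: le_trans (gb 0%N).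
have hq i : (forall n, `|unstable_sum g n i - unstable_sum g 0 i| <=
    c * b / (1 - lam)) /\ cvg (unstable_sum g ^~ i @ \oo).
  apply: geometric_cvg; rewrite ?l0 ?mulr_ge0// => n.
  rewrite unstable_sumB; apply: le_trans (dich_unstable dich _ _ _) _.
  rewrite -!mulrA ler_wpM2l// mulrC ler_pM ?exprn_ge0//.
  by rewrite exprS ler_piMl ?exprn_ge0// ltW.
pose q i : 'cV[R]_m := lim (unstable_sum g ^~ i @ \oo).
have qcvg i : unstable_sum g ^~ i @ \oo --> q i by have [_ /cvgP] := hq i.
(* The defining recursion of [unstable_sum], with n shifted by one, passes to the limit in n. *)
have qS i : A i *m q i = Pu i.+1 *m g i + q i.+1.
  suff -> : q i = invmx (A i) *m (Pu i.+1 *m g i + q i.+1).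
    by rewrite mulmxA mulmxV ?mul1mx//; exact: (dich_unit dich).
  have h1 : unstable_sum g n.+1 i @[n --> \oo] --> q i.
    by have := qcvg i; rewrite -(cvg_shiftS (unstable_sum g ^~ i)).
  have h2 : unstable_sum g n.+1 i @[n --> \oo] -->
      invmx (A i) *m (Pu i.+1 *m g i + q i.+1).
    apply: (@cvg_comp _ _ _ _ (fun x => invmx (A i) *m x)
      _ _ _ _ (mulmx_continuous (M := invmx (A i)) (x := _))).
    by apply: cvgD; [exact: cvg_cst|exact: qcvg].
  exact: cvg_unique h1 h2.
exists (fun i => stable_part g i - q i); split=> [i|i].
  rewrite stable_partS mulmxBr qS.
  have {3}<- : Ps i.+1 *m g i + Pu i.+1 *m g i = g i.
    by rewrite -mulmxDl (dich_sum dich) mul1mx.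
  move: (A i *m _) (Ps i.+1 *m _) (Pu i.+1 *m _) (q i.+1) => x1 x2 x3 x4.
  by apply/matrixP => k j; rewrite !mxE; ring.
apply: le_trans (ler_normB _ _) _.
have -> : 2 * c / (1 - lam) * b = c / (1 - lam) * b + c * b / (1 - lam) by ring.
apply: lerD; first exact: stable_part_le.
have := cvg_norm_le (qcvg i) (hq i).1.
by rewrite subr0.
Qed.

End Dichotomy.
End Cocycles.

(** * Small Lipschitz perturbations of a dichotomy *)

Section Perturbation.
Context {R : realType} {m : nat}.
Context (A Ps Pu : nat -> 'M[R]_m) (c lam : R).
Hypothesis dich : dichotomy A Ps Pu c lam.
Hypothesis c_ge0 : 0 <= c.
Let K := 2 * c / (1 - lam).

(** Each correction is the bounded linear solution for the last change of [h], and K eta <= 1/2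
    halves it. Starting from K b, the corrections add up to at most 2 K b <= r, so the iterates stay
    where [h] is Lipschitz. *)
Lemma nonlinear_shadowing (h : nat -> 'cV[R]_m -> 'cV[R]_m) (eta b r : R) :
  0 <= eta -> K * eta <= 2^-1 -> 2 * K * b <= r ->
  (forall i, `|h i 0| <= b) ->
  (forall i x y, `|x| <= r -> `|y| <= r -> `|h i x - h i y| <= eta * `|x - y|) ->
  exists y : nat -> 'cV[R]_m, (forall i, y i.+1 = A i *m y i + h i (y i)) /\
    forall i, `|y i| <= 2 * K * b.
Proof.
move=> eta0 Keta Kbr hb hlip.
have b0 : 0 <= b by apply: le_trans (hb 0%N).
have K0 : 0 <= K.
  by have /andP[_ ?] := dich_rate dich; rewrite !mulr_ge0// invr_ge0 subr_ge0 ltW.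
(* Choice fixes one solution [G p] for every inhomogeneity and bound; if the bound fails, the zero
   sequence is a default value. *)
have /boolp.choice[G HG] : forall p : (nat -> 'cV[R]_m) * R,
    exists w : nat -> 'cV[R]_m, (forall i, `|p.1 i| <= p.2) ->
      (forall i, w i.+1 = A i *m w i + p.1 i) /\ forall i, `|w i| <= K * p.2.
  move=> p.
  have [pb|npb] := pselect (forall i, `|p.1 i| <= p.2); last by exists (fun=> 0).
  by have [w hw] := linear_shadowing dich c_ge0 pb; exists w.
clearbody K.
(* Picard iteration: the first component is the current approximation and the
   second one the next correction. *)
pose step k (p : (nat -> 'cV[R]_m) * (nat -> 'cV[R]_m)) :=
  (fun i => p.1 i + p.2 i,
   G (fun i => h i (p.1 i + p.2 i) - h i (p.1 i), eta * (K * b * 2^-1 ^+ k))).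
pose P := fix P k := if k is k'.+1 then step k' (P k')
  else (fun=> 0, G (fun i => h i 0, b)).
have Kb0 : 0 <= 2 * K * b by rewrite mulr_ge0// mulr_ge0.
(* The partial sums of the bounds K b / 2^k are 2 K b (1 - 2^-k). The third clause says that the
   next iterate solves the recursion with [h] frozen at the current one. *)
have inv k : [/\ forall i, `|(P k).1 i| <= 2 * K * b * (1 - 2^-1 ^+ k),
    forall i, `|(P k).2 i| <= K * b * 2^-1 ^+ k &
    forall i, (P k).1 i.+1 + (P k).2 i.+1 =
       A i *m ((P k).1 i + (P k).2 i) + h i ((P k).1 i)].
  elim: k => [|k [IH1 IH2 IH3]].
    have [H1 H2] := HG (fun i => h i 0, b) hb.
    split=> i /=; first by rewrite normr0 expr0 subrr mulr0.
      by rewrite expr0 mulr1; exact: H2.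
    by rewrite !add0r; exact: H1.
  have h2 : (2^-1 : R) ^+ k.+1 = 2^-1 * 2^-1 ^+ k by rewrite exprS.
  have p0 : 0 <= (2^-1 : R) ^+ k by rewrite exprn_ge0.
  have w1 i : `|(P k).1 i + (P k).2 i| <= 2 * K * b * (1 - 2^-1 ^+ k.+1).
    apply: le_trans (ler_normD _ _) _; apply: le_trans (lerD (IH1 i) (IH2 i)) _.
    by rewrite h2 le_eqVlt; apply/orP; left; apply/eqP; move: (_ ^+ k) => q; field.
  have ler k' : 2 * K * b * (1 - 2^-1 ^+ k') <= r.
    apply: le_trans Kbr; rewrite ler_piMr// lerBlDr lerDl exprn_ge0//.
  have gb i : `|h i ((P k).1 i + (P k).2 i) - h i ((P k).1 i)| <=
      eta * (K * b * 2^-1 ^+ k).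
    apply: le_trans (hlip _ _ _ _ _) _.
    - exact: le_trans (w1 i) (ler _).
    - exact: le_trans (IH1 i) (ler _).
    - by rewrite addrC addKr ler_wpM2l.
  have [H1 H2] := HG (_, _) gb.
  split=> i.
  - exact: w1.
  - apply: le_trans (H2 i) _; rewrite /= h2.
    have -> : K * (eta * (K * b * 2^-1 ^+ k)) = (K * eta) * (K * b * 2^-1 ^+ k).
      by ring.
    have -> : K * b * (2^-1 * 2^-1 ^+ k) = 2^-1 * (K * b * 2^-1 ^+ k) by ring.
    by rewrite ler_wpM2r// mulr_ge0// mulr_ge0.
  - rewrite [P k.+1]/= [X in X + _]/= IH3 [X in _ + X]H1 /=.
    move: (G _ _) => x1; rewrite !mulmxDr.
    move: (A i *m _) (A i *m _) (A i *m _) (h i _) (h i _) => x2 x3 x4 x5 x6.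
    by apply/matrixP => k' j; rewrite !mxE; ring.
have half : 0 <= (2^-1 : R) < 1 by rewrite invr_ge0 ler0n invf_lt1 ?ltr1n.
have wcvg i : (forall n, `|(P n).1 i - (P 0%N).1 i| <= K * b / (1 - 2^-1)) /\
    cvg ((fun k => (P k).1 i) @ \oo).
  apply: geometric_cvg; rewrite ?mulr_ge0// => k.
  by have [_ + _] := inv k; move=> /(_ i); rewrite [P k.+1]/= addrC addKr.
pose y i : 'cV[R]_m := lim ((fun k => (P k).1 i) @ \oo).
have yc i : (fun k => (P k).1 i) @ \oo --> y i by have [_ /cvgP] := wcvg i.
have yb i : `|y i| <= 2 * K * b.
  have -> : 2 * K * b = K * b / (1 - 2^-1) by field.
  by have := cvg_norm_le (yc i) (wcvg i).1; rewrite /= subr0.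
exists y; split=> // i.
have h1 : (fun k => (P k.+1).1 i.+1) @ \oo --> y i.+1.
  by have := yc i.+1; rewrite -(cvg_shiftS (fun k => (P k).1 i.+1)).
have h2 : (fun k => (P k.+1).1 i.+1) @ \oo --> A i *m y i + h i (y i).
  rewrite (_ : (fun k => _) = fun k => A i *m (P k.+1).1 i + h i ((P k).1 i)); last first.
    by apply/funext => k; have [_ _ /(_ i)] := inv k.
  apply: cvgD.
    apply: (@cvg_comp _ _ _ (fun k => (P k.+1).1 i) (fun x => A i *m x)
      _ _ _ _ (mulmx_continuous (M := A i) (x := _))).
    by have := yc i; rewrite -(cvg_shiftS (fun k => (P k).1 i)).
  apply/(@cvgrPdist_le _ _ _ (nbhs \oo)) => e e0.
  have e1 : 0 < eta + 1 by rewrite ltr_wpDl.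
  near=> k.
  have hk : `|y i - (P k).1 i| <= e / (eta + 1).
    by near: k; apply: cvgr_dist_le (yc i) _ (divr_gt0 e0 e1).
  apply: le_trans (hlip _ _ _ _ _) _.
  - exact: le_trans (yb i) Kbr.
  - have [+ _ _] := inv k; move=> /(_ i) /le_trans; apply.
    by apply: le_trans Kbr; rewrite ler_piMr// lerBlDr lerDl exprn_ge0.
  - move: hk; rewrite ler_pdivlMr// mulrC; apply: le_trans.
    by rewrite ler_wpM2r// lerDl.
exact: cvg_unique h1 h2.
Unshelve. all: by end_near. Qed.

End Perturbation.

(** * Strict differentiability of C^1 maps, uniformly on compact sets *)

Section StrictDifferentiability.
Context {R : realType}.

(** On the ball of radius d about z0, the map minus its linearisation at z0 is e-Lipschitz. The
    two-point form supplies the Lipschitz constants of the fixed point iterations. *)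
Definition strictly_differentiable (V W : normedModType R) (g : V -> W) (z0 : V)
    (e d : R) : Prop :=
  forall z z', `|z - z0| < d -> `|z' - z0| < d ->
    `|g z - g z' - 'd g z0 (z - z')| <= e * `|z - z'|.

Lemma mean_value_diff (V : normedModType R) (g : V -> R) (z z' : V) :
  (forall y, differentiable g y) ->
  exists2 t : R, 0 <= t <= 1 & g z - g z' = 'd g (z' + t *: (z - z')) (z - z').
Proof.
move=> dg; set w := z - z'.
pose phi (t : R) := g (z' + t *: w).
have dphi (t : R) : is_derive t 1 phi ('d g (z' + t *: w) w).
  have da : is_diff t (fun t : R => z' + t *: w) (fun h => 0 + h *: w).
    exact: is_diffD.
  have dgt := differentiableP (dg (z' + t *: w)).
  have dc : is_diff t (g \o (fun t : R => z' + t *: w))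
     ('d g (z' + t *: w) \o (fun h => 0 + h *: w)) by exact: is_diff_comp.
  split; first by apply: diff_derivable; exact: ex_diff.
  rewrite deriveE; last exact: ex_diff.
  by rewrite diff_val /= add0r scale1r.
have [|t t01 E] := @MVT_segment R phi (fun t => 'd g (z' + t *: w) w) 0 1 ler01
  (fun t _ => dphi t).
  apply: derivable_within_continuous => t _.
  by have [] := dphi t.
exists t; first by move: t01; rewrite in_itv.
move: E; rewrite /phi scale1r scale0r addr0 subr0 mulr1 => <-.
by rewrite /w addrCA subrr addr0.
Qed.

(** The mean value point lies on the segment from z' to z, hence by convexity in the ball where the
    differential is e-close to the one at z0. *)
Lemma C1_strictly_differentiable_real (V : normedModType R) (g : V -> R) z0 e :
  C1 g -> 0 < e -> \forall d \near 0^'+, strictly_differentiable g z0 e d.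
Proof.
move=> [dg cg] e0.
have /nbhs_ballP[d0 /= d00 hd0] := cg z0 e e0.
near=> d => z z' zd z'd.
have [t /andP[t0 t1] ->] := mean_value_diff z z' dg.
apply: hd0; rewrite -ball_normE /= distrC.
have -> : z' + t *: (z - z') - z0 = (1 - t) *: (z' - z0) + t *: (z - z0).
  rewrite scalerBl scale1r -[RHS]addrA [X in _ = _ + X]addrC -scalerBr.
  by rewrite [- (z' - z0)]opprB subrKA addrAC.
apply: (@lt_le_trans _ _ d); last by near: d; exact: nbhs_right_le.
apply: le_lt_trans (ler_normD _ _) _; rewrite !normrZ.
rewrite (ger0_norm t0) ger0_norm ?subr_ge0//.
have [zz|zz] := leP `|z' - z0| `|z - z0|.
  apply: le_lt_trans zd; apply: le_trans (lerD (ler_wpM2l _ zz) (lexx _)) _.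
    by rewrite subr_ge0.
  by rewrite -mulrDl subrK mul1r.
apply: le_lt_trans z'd; apply: le_trans (lerD (lexx _) (ler_wpM2l t0 (ltW zz))) _.
by rewrite -mulrDl subrK mul1r.
Unshelve. all: by end_near. Qed.

Lemma diff_coord (V : normedModType R) p q (g : V -> 'M[R]_(p, q)) z i j :
  differentiable g z ->
  differentiable (fun y => g y i j) z /\
  forall h, 'd (fun y => g y i j) z h = 'd g z h i j.
Proof.
move=> dg.
have dc := differentiable_coord (g z) i j.
have dcE : 'd (fun N : 'M[R]_(p, q) => N i j : R) (g z) =
    (fun N : 'M[R]_(p, q) => N i j : R) :> ('M[R]_(p, q) -> R).
  have @f : {linear 'M[R]_(p, q) -> R}.
    by exists (fun N : 'M[R]_(_, _) => N i j); do 2![eexists]; do ?[constructor];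
     rewrite ?mxE// => ? *; rewrite ?mxE//; move=> ?; rewrite !mxE.
  by rewrite (_ : (fun _ => _) = f) // diff_lin//; exact: coord_continuous.
split; first exact: (differentiable_comp dg dc).
move=> h.
by rewrite (_ : (fun y => g y i j) = (fun N : 'M[R]_(p, q) => N i j : R) \o g)//
  diff_comp//= dcE.
Qed.

(** The mean value equality fails for vector values, so it is used entry by entry; the entries are
    finite in number and the norm is their maximum. *)
Lemma C1_strictly_differentiable_mx (V : normedModType R) p q
    (g : V -> 'M[R]_(p, q)) z0 e :
  C1 g -> 0 < e -> \forall d \near 0^'+, strictly_differentiable g z0 e d.
Proof.
move=> [dg cg] e0.
have H : forall ij : 'I_p * 'I_q, \forall d \near 0^'+,
    strictly_differentiable (fun y => g y ij.1 ij.2) z0 e d.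
  move=> [i j]; apply: C1_strictly_differentiable_real => //; split=> [z|z e' e'0].
    by have [] := diff_coord i j (dg z).
  apply: filterS (cg z e' e'0) => z' hz' h.
  rewrite (diff_coord i j (dg z)).2 (diff_coord i j (dg z')).2.
  apply: le_trans (hz' h).
  by have := mx_norm_coord ('d g z' h - 'd g z h) i j; rewrite !mxE.
have H' := filter_forall _ H; near=> d => z z' zd z'd.
have hd : forall ij : 'I_p * 'I_q,
    strictly_differentiable (fun y => g y ij.1 ij.2) z0 e d
  by near: d; exact: H'.
apply: mx_norm_le => [|i j]; first by rewrite mulr_ge0// ltW.
have := hd (i, j) z z' zd z'd.
by rewrite (diff_coord i j (dg z0)).2 !mxE.
Unshelve. all: by end_near. Qed.

(** Near z0, the remainder of the linearisation at z0 and the replacement of the differential at z0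
    by that at z cost e / 2 each; compactness then gives one radius for all of [A]. *)
Lemma strictly_differentiable_compact (V W : normedModType R) (g : V -> W)
    (A : set V) e :
  (forall z e', 0 < e' -> \forall d \near 0^'+, strictly_differentiable g z e' d) ->
  C1 g -> compact A -> 0 < e ->
  exists2 d, 0 < d & forall z, A z -> strictly_differentiable g z e d.
Proof.
move=> sg [dg cg] /compact_near_coveringP cA e0.
have e20 : 0 < e / 2 by rewrite divr_gt0.
have : \forall d \near 0^'+, A `<=` [set z | strictly_differentiable g z e d].
  apply: (cA _ _ (fun d z => strictly_differentiable g z e d)) => z0 Az0.
  have [d0 [d00 hd0]] : exists d0, 0 < d0 /\ strictly_differentiable g z0 (e / 2) d0.
    near (0 : R)^'+ => d0; exists d0; split=> //.
    by near: d0; exact: sg.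
  near=> z d => /= y y' yd y'd.
  have hz : forall h, `|'d g z h - 'd g z0 h| <= e / 2 * `|h|.
    by near: z; exact: cg.
  have zd : `|z - z0| < d0 / 2.
    by near: z; apply: cvgr_distC_lt => //; rewrite divr_gt0.
  have dd : d <= d0 / 2 by near: d; apply: nbhs_right_le; rewrite divr_gt0.
  have near0 x : `|x - z| < d -> `|x - z0| < d0.
    move=> xd; rewrite -(subrKA z); apply: le_lt_trans (ler_normD _ _) _.
    by rewrite (splitr d0) ltrD// (lt_le_trans xd).
  have := hd0 y y' (near0 _ yd) (near0 _ y'd).
  have h2 := hz (y - y').
  move=> h1; rewrite -(subrKA ('d g z0 (y - y'))).
  apply: le_trans (ler_normD _ _) _; rewrite distrC in h2.
  by apply: le_trans (lerD h1 h2) _; rewrite -mulrDl -splitr.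
move=> h; near (0 : R)^'+ => d.
have hd : A `<=` [set z | strictly_differentiable g z e d] by near: d; exact: h.
by exists d.
Unshelve. all: by end_near. Qed.

Lemma diff_bounded_compact (V W : normedModType R) (g : V -> W) (A : set V) :
  C1 g -> compact A ->
  exists2 k, 0 < k & forall z, A z -> forall h, `|'d g z h| <= k * `|h|.
Proof.
move=> [dg cg] /compact_near_coveringP cA.
have : \forall k \near +oo, A `<=` [set z | forall h, `|'d g z h| <= k * `|h|].
  apply: (cA _ _ (fun k z => forall h, `|'d g z h| <= k * `|h|)) => z0 Az0.
  have [k0 k00 hk0] := linear_lipschitz (diff_continuous (dg z0)).
  near=> z k.
  have hk : 1 + k0 <= k.
    by near: k; apply: nbhs_pinfty_ge; rewrite realE addr_ge0// ltW.
  move=> /= h; have hz : forall h, `|'d g z h - 'd g z0 h| <= 1 * `|h|.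
    by near: z; exact: cg.
  rewrite -[X in `|X|](subrK ('d g z0 h)); apply: le_trans (ler_normD _ _) _.
  apply: le_trans (lerD (hz h) (hk0 h)) _; rewrite -mulrDl ler_wpM2r//.
move=> h; have [k [hk k0]] := filter_ex (filterI h (nbhs_pinfty_gt (num_real 0))).
by exists k.
Unshelve. all: by end_near. Qed.

End StrictDifferentiability.

(** * Jacobian matrices and differentiability of the inverse map *)

Section DiffMatrix.
Context {R : realType}.

Lemma differentiable_eps (V W : normedModType R) (f : V -> W) (df : {linear V -> W}) x :
  continuous df ->
  (forall e, 0 < e -> \forall h \near 0, `|f (h + x) - f x - df h| <= e * `|h|) ->
  differentiable f x /\ 'd f x = df :> (V -> W).
Proof.
move=> cdf H.
have E : f \o shift x = cst (f x) + df +o_ 0 id.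
  apply/eqaddoP => _/posnumP[e].
  have := H e%:num [gt0 of e%:num]; apply: filterS => h /=.
  by rewrite opprD addrA.
have dE := diff_unique cdf E.
by split=> //; apply/diff_locallyP; rewrite dE.
Qed.

Definition jacmx m (F : 'cV[R]_m -> 'cV[R]_m) x : 'M[R]_m :=
  \matrix_(i, j) ('d F x (delta_mx j 0) i 0).

Lemma jacmxE m (F : 'cV[R]_m -> 'cV[R]_m) x v : 'd F x v = jacmx F x *m v.
Proof.
rewrite {1}[v]matrix_sum_delta linear_sum; apply/colP => i.
rewrite summxE mxE; apply: eq_bigr => j _.
by rewrite big_ord1 linearZ /= !mxE mulrC.
Qed.

Lemma jacmx_unit m (F : 'cV[R]_m -> 'cV[R]_m) x :
  bijective ('d F x) -> jacmx F x \in unitmx.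
Proof.
move=> [g gK Kg].
suff /mulmx1_unit[] : jacmx F x *m (\matrix_(i, j) (g (delta_mx j 0) i 0)) = 1%:M by [].
apply/matrixP => i j.
have -> : (jacmx F x *m \matrix_(i, j) (g (delta_mx j 0) i 0)) i j =
    (jacmx F x *m g (delta_mx j 0)) i 0.
  by rewrite !mxE; apply: eq_bigr => k _; rewrite !mxE.
by rewrite -jacmxE Kg !mxE eqxx andbT.
Qed.

(** Newton iteration with the derivative frozen at x. As [B] inverts that derivative, each increment
    is, up to sign, [B] applied to a linearisation error, and the constant 1/(2k) halves it. *)
Lemma inverse_function_near m (F : 'cV[R]_m -> 'cV[R]_m) (B : 'M[R]_m) (x : 'cV[R]_m)
    (k d : R) :
  (forall z, {for z, continuous F}) -> B \in unitmx -> B *m jacmx F x = 1%:M ->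
  0 < k -> (forall v : 'cV[R]_m, `|B *m v| <= k * `|v|) ->
  strictly_differentiable F x (2 * k)^-1 d ->
  forall y, 2 * k * `|y - F x| < d -> exists2 z, F z = y & `|z - x| <= 2 * k * `|y - F x|.
Proof.
move=> cF uB BA k0 Bk sF y yd.
pose z := fix z n := if n is n'.+1 then z n' + B *m (y - F (z n')) else x.
set b := `|y - F x| in yd *.
have b0 : 0 <= b by exact: normr_ge0.
have kb0 : 0 <= k * b by rewrite mulr_ge0// ltW.
have inv n : `|z n - x| <= 2 * k * b * (1 - 2^-1 ^+ n) /\
    `|z n.+1 - z n| <= k * b * 2^-1 ^+ n.
  elim: n => [|n [IH1 IH2]].
    by rewrite /= subrr normr0 expr0 subrr mulr0 mulr1 addrC addKr.
  have q0 : 0 <= (2^-1 : R) ^+ n by rewrite exprn_ge0.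
  have h2 : (2^-1 : R) ^+ n.+1 = 2^-1 * 2^-1 ^+ n by rewrite exprS.
  have lt_d n' : 2 * k * b * (1 - 2^-1 ^+ n') < d.
    apply: le_lt_trans yd; rewrite ler_piMr// ?lerBlDr ?lerDl ?exprn_ge0//.
    by rewrite -mulrA mulr_ge0.
  have w1 : `|z n.+1 - x| <= 2 * k * b * (1 - 2^-1 ^+ n.+1).
    rewrite -(subrKA (z n)); apply: le_trans (ler_normD _ _) _.
    apply: le_trans (lerD IH2 IH1) _.
    by rewrite h2 le_eqVlt; apply/orP; left; apply/eqP; move: (_ ^+ n) => q; field.
  split=> //.
  have -> : z n.+2 - z n.+1 = - (B *m (F (z n.+1) - F (z n) - 'd F x (z n.+1 - z n))).
    rewrite jacmxE mulmxBr mulmxA BA mul1mx.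
    rewrite -[z n.+2]/(z n.+1 + B *m (y - F (z n.+1))).
    rewrite -[z n.+1 - z n]/(z n + B *m (y - F (z n)) - z n).
    rewrite !mulmxBr.
    move: (z n.+1) (z n) (B *m _) (B *m _) (B *m _) => a1 a2 a3 a4 a5.
    by apply/matrixP => i j; rewrite !mxE; ring.
  rewrite normrN; apply: le_trans (Bk _) _.
  have := sF (z n.+1) (z n) (le_lt_trans w1 (lt_d _)) (le_lt_trans IH1 (lt_d _)).
  move=> /(ler_wpM2l (ltW k0)) /le_trans; apply.
  rewrite mulrA (_ : k * (2 * k)^-1 = 2^-1); last by field; rewrite gt_eqF.
  by rewrite h2 mulrCA ler_wpM2l.
have half : 0 <= (2^-1 : R) < 1 by rewrite invr_ge0 ler0n invf_lt1 ?ltr1n.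
have [zb zc] := geometric_cvg half kb0 (fun n => (inv n).2).
pose l : 'cV[R]_m := lim (z @ \oo).
have zl : z @ \oo --> l by move/cvgP: zc.
have lb : `|l - x| <= 2 * k * b.
  have -> : 2 * k * b = k * b / (1 - 2^-1) by field.
  exact: cvg_norm_le zl zb.
exists l => //.
have h1 : z n.+1 @[n --> \oo] --> l by have := zl; rewrite -(cvg_shiftS z).
have h2 : z n.+1 @[n --> \oo] --> l + B *m (y - F l).
  apply: cvgD => //.
  apply: (@cvg_comp _ _ _ (fun n => y - F (z n)) (fun x => B *m x)
    _ _ _ _ (mulmx_continuous (M := B) (x := _))).
  apply: cvgB; first exact: cvg_cst.
  exact: (@cvg_comp _ _ _ z F _ _ _ zl (cF l)).
have : l + 0 = l + B *m (y - F l) by rewrite addr0; exact: cvg_unique h1 h2.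
move/addrI/(congr1 (mulmx (invmx B))); rewrite mulmx0 mulmxA mulVmx// mul1mx.
by move/esym/eqP; rewrite subr_eq0 => /eqP.
Qed.

(** The preimage z of h + F x found near x must be G (h + F x), which gives |z - x| <= 2k |h|.
    Strict differentiability of F at x turns this into an o(|h|) remainder for G. *)
Lemma inverse_differentiable m (F G : 'cV[R]_m -> 'cV[R]_m) x :
  C1 F -> cancel F G -> bijective ('d F x) -> differentiable G (F x).
Proof.
move=> C1F FK bF.
have uA := jacmx_unit bF.
set A := jacmx F x in uA.
pose B := invmx A.
pose k := m%:R * `|B| + 1.
have k0 : 0 < k by rewrite ltr_wpDl// mulr_ge0.
have Bk (v : 'cV[R]_m) : `|B *m v| <= k * `|v|.
  by apply: le_trans (mulmx_norm_le _ _) _; rewrite ler_wpM2r// lerDl.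
have BA : B *m A = 1%:M by rewrite mulVmx.
have uB : B \in unitmx by rewrite unitmx_inv.
have cF z : {for z, continuous F} by apply: differentiable_continuous; exact: C1F.1.
have cB : continuous (mulmx B : 'cV[R]_m -> 'cV[R]_m).
  exact: mulmx_continuous.
have [] // := @differentiable_eps _ _ G (mulmx B : {linear 'cV[R]_m -> 'cV[R]_m}) (F x) cB.
move=> e e0.
(* The linearisation error is amplified by k through [B] and by 2k through |z - x| <= 2k |h|. *)
have e'0 : 0 < e / (2 * k * k) by rewrite divr_gt0// !mulr_gt0.
have k20 : 0 < (2 * k)^-1 by rewrite invr_gt0 mulr_gt0.
have [d [d0 sd sd']] : exists d, [/\ 0 < d, strictly_differentiable F x (2 * k)^-1 d &
    strictly_differentiable F x (e / (2 * k * k)) d].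
  near (0 : R)^'+ => d; exists d; split=> //.
    by near: d; exact: C1_strictly_differentiable_mx.
  by near: d; exact: C1_strictly_differentiable_mx.
have dk0 : 0 < d / (2 * k) by rewrite divr_gt0// mulr_gt0.
have hN : \forall h \near (0 : 'cV[R]_m), `|h| < d / (2 * k).
  have := nbhsx_ballx (0 : 'cV[R]_m) _ dk0; apply: filterS => h.
  by rewrite -ball_normE /= sub0r normrN.
near=> h.
have hd : 2 * k * `|h| < d.
  by rewrite mulrC -ltr_pdivlMr ?mulr_gt0//; near: h; exact: hN.
have := @inverse_function_near m F B x k d cF uB BA k0 Bk sd (h + F x).
rewrite addrK => /(_ hd)[z Fz zx].
have -> : G (h + F x) = z by rewrite -Fz FK.
rewrite FK.
have -> : z - x - B *m h = - (B *m (F z - F x - 'd F x (z - x))).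
  rewrite Fz addrK jacmxE -/A mulmxBr (mulmxA B) BA mul1mx.
  by rewrite opprB.
rewrite normrN; apply: le_trans (Bk _) _.
have zd : `|z - x| < d by exact: le_lt_trans zx hd.
have xd : `|x - x| < d by rewrite subrr normr0.
move: (sd' z x zd xd) => /(ler_wpM2l (ltW k0)) /le_trans; apply.
have -> : k * (e / (2 * k * k) * `|z - x|) = e / (2 * k) * `|z - x|.
  by field; rewrite gt_eqF.
apply: (@le_trans _ _ (e / (2 * k) * (2 * k * `|h|))).
  by rewrite ler_wpM2l// divr_ge0 ?ltW// mulr_gt0.
by rewrite le_eqVlt; apply/orP; left; apply/eqP; field; rewrite gt_eqF.
Unshelve. all: by end_near. Qed.

End DiffMatrix.

(** * Comparison of the Euclidean norm with the sup norm *)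

Section Euclidean.
Context {R : realType} {m : nat}.
Implicit Types (v w : 'cV[R]_m).

Lemma dotpE v w : dotp v w = \sum_i v i 0 * w i 0.
Proof. by rewrite /dotp mxE; apply: eq_bigr => i _; rewrite mxE. Qed.

Lemma dotpDr v w w' : dotp v (w + w') = dotp v w + dotp v w'.
Proof. by rewrite /dotp mulmxDr mxE. Qed.

Lemma dotp_ge0 v : 0 <= dotp v v.
Proof. by rewrite dotpE; apply: sumr_ge0 => i _; rewrite -expr2 sqr_ge0. Qed.

Lemma norm_le_enorm v : `|v| <= enorm v.
Proof.
apply: mx_norm_le => [|i j]; first exact: sqrtr_ge0.
rewrite (ord1 j) -sqrtr_sqr ler_sqrt ?dotp_ge0// dotpE (bigD1 i)//= -expr2 lerDl.
by apply: sumr_ge0 => k _; rewrite -expr2 sqr_ge0.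
Qed.

Lemma dotp_le v : dotp v v <= m%:R * `|v| ^+ 2.
Proof.
rewrite dotpE mulr_natl -[X in _ *+ X]card_ord -sumr_const.
apply: ler_sum => k _; rewrite -expr2 -[X in X <= _]ger0_norm ?sqr_ge0// normrX.
by rewrite lerXn2r ?nnegrE// mx_norm_coord.
Qed.

Lemma enorm_le v : enorm v <= Num.sqrt m%:R * `|v|.
Proof.
rewrite -[X in _ * X](ger0_norm (normr_ge0 v)) -sqrtr_sqr -sqrtrM ?ler0n//.
by rewrite ler_sqrt ?mulr_ge0 ?sqr_ge0// dotp_le.
Qed.

Lemma dotp_eq0 v : dotp v v = 0 -> v = 0.
Proof.
move=> v0; apply/eqP; rewrite -normr_le0; apply: le_trans (norm_le_enorm v) _.
by rewrite /enorm v0 sqrtr0.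
Qed.

End Euclidean.

(** * Projections along a direct sum, bounded uniformly on a compact set *)

Section ObliqueProjections.
Context {R : realType} {m : nat}.
Implicit Types (U V : {vspace 'cV[R]_m}) (P Q : 'M[R]_m).

Lemma unitmx_injective (N : 'M[R]_m) :
  (forall y : 'cV[R]_m, N *m y = 0 -> y = 0) -> N \in unitmx.
Proof.
move=> H; rewrite -unitmx_tr -row_free_unit -kermx_eq0; apply/rowV0P => w.
move=> /sub_kermxP wN; apply: trmx_inj; rewrite trmx0; apply: H.
by rewrite -[N]trmxK -trmx_mul wN trmx0.
Qed.

(** If P y = Q y, this vector lies in both subspaces and vanishes. Then y is orthogonal to U and to
    V, hence to itself. *)
Lemma orthogonal_projectors_sub_unit P Q U V :
  orthogonal_projector P U -> orthogonal_projector Q V ->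
  (U + V)%VS = fullv -> (U :&: V)%VS = 0%VS -> P - Q \in unitmx.
Proof.
move=> HP HQ UV UV0; apply: unitmx_injective => y.
rewrite mulmxBl => /eqP; rewrite subr_eq0 => /eqP E.
have Py0 : P *m y = 0.
  apply/eqP; rewrite -memv0 -UV0 memv_cap (HP y).1 E.
  exact: (HQ y).1.
have Qy0 : Q *m y = 0 by rewrite -E.
have /memv_addP[y1 y1U [y2 y2V yE]] : y \in (U + V)%VS by rewrite UV memvf.
apply: dotp_eq0; rewrite {2}yE dotpDr.
have := (HP y).2 _ y1U; have := (HQ y).2 _ y2V.
by rewrite Py0 Qy0 !subr0 => -> ->; rewrite addr0.
Qed.

(* Writing y := (P - Q)^-1 v for the orthogonal projectors P, Q, the identity
   v = P y - Q y is the decomposition of v along the direct sum. *)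
Definition oblique P Q : 'M[R]_m := P *m invmx (P - Q).

Lemma obliqueD P Q : P - Q \in unitmx -> oblique P Q + oblique Q P = 1%:M.
Proof.
move=> uN; rewrite /oblique -(opprB P Q).
have -> : invmx (- (P - Q)) = - invmx (P - Q).
  have uN' : - (P - Q) \in unitmx by rewrite -scaleN1r unitmxZ ?unitrN1.
  rewrite -[RHS]mul1mx -(mulVmx uN') -mulmxA mulmxN mulNmx opprK mulmxV//.
  by rewrite mulmx1.
by rewrite mulmxN -mulmxBl mulmxV.
Qed.

(** The error in the first component lies in U; it is the opposite of the error in the second one,
    so it also lies in V. *)
Lemma oblique_unique P Q U V a b :
  orthogonal_projector P U -> orthogonal_projector Q V ->
  (U + V)%VS = fullv -> (U :&: V)%VS = 0%VS -> a \in U -> b \in V ->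
  oblique P Q *m (a + b) = a.
Proof.
move=> HP HQ UV UV0 aU bV.
have uN := orthogonal_projectors_sub_unit HP HQ UV UV0.
have E := obliqueD uN.
apply/eqP; rewrite -subr_eq0 -memv0 -UV0 memv_cap; apply/andP; split.
  by rewrite rpredB// /oblique -mulmxA (HP _).1.
have -> : oblique P Q *m (a + b) - a = b - oblique Q P *m (a + b).
  apply/eqP; rewrite subr_eq -addrA [- _ + a]addrC addrA [b + a]addrC.
  by rewrite eq_sym subr_eq -mulmxDl E mul1mx.
by rewrite rpredB// /oblique -mulmxA (HQ _).1.
Qed.

(** A small perturbation of the invertible matrix P - Q has an inverse of comparable norm, so the
    projections are locally bounded, and compactness makes the bound uniform. *)
Lemma oblique_bounded (A : set 'cV[R]_m) (P Q : 'cV[R]_m -> 'M[R]_m) :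
  compact A -> {within A, continuous P} -> {within A, continuous Q} ->
  (forall x, A x -> P x - Q x \in unitmx) ->
  exists2 k, 0 < k & forall x, A x -> forall v : 'cV[R]_m, `|oblique (P x) (Q x) *m v| <= k * `|v|.
Proof.
move=> /compact_near_coveringP/near_covering_withinP cA
  /subspace_continuousP cP /subspace_continuousP cQ uPQ.
have H : \forall k \near +oo,
    A `<=` [set x | forall v : 'cV[R]_m, `|oblique (P x) (Q x) *m v| <= k * `|v|].
  apply: (cA _ _ (fun k x => forall v : 'cV[R]_m, `|oblique (P x) (Q x) *m v| <= k * `|v|)).
  move=> x0 Ax0.
  pose N x := P x - Q x.
  have uN0 : N x0 \in unitmx by exact: uPQ.
  pose k0 := m%:R * `|invmx (N x0)| + 1.
  have k00 : 0 < k0 by rewrite ltr_wpDl// mulr_ge0.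
  have hk0 (v : 'cV[R]_m) : `|invmx (N x0) *m v| <= k0 * `|v|.
    by apply: le_trans (mulmx_norm_le _ _) _; rewrite ler_wpM2r// lerDl.
  have cN : N x @[x --> within A (nbhs x0)] --> N x0.
    by apply: cvgB; [exact: cP|exact: cQ].
  (* This distance makes the perturbation of [N x0] have operator norm at most 1/(2 k0), the factor
     m coming from [mulmx_norm_le]. *)
  have e0 : 0 < (2 * k0 * (m%:R + 1))^-1.
    by rewrite invr_gt0 !mulr_gt0// ltr_wpDl.
  have hN : \forall x \near x0, A x -> `|N x0 - N x| <= (2 * k0 * (m%:R + 1))^-1.
    exact: (@cvgr_dist_le _ _ _ _ _ _ _ cN _ e0).
  have hP : \forall x \near x0, A x -> `|P x0 - P x| <= 1.
    exact: (@cvgr_dist_le _ _ _ _ _ _ _ (cP _ Ax0) _ ltr01).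
  near=> x k.
  have hNx : A x -> `|N x0 - N x| <= (2 * k0 * (m%:R + 1))^-1 by near: x.
  have hPx : A x -> `|P x0 - P x| <= 1 by near: x.
  have hk : m%:R * (`|P x0| + 1) * (2 * k0) <= k.
    by near: k; apply: nbhs_pinfty_ge; rewrite num_real.
  move=> Ax v; move: (hNx Ax) (hPx Ax) => {}hNx {}hPx.
  have uN : N x \in unitmx by exact: uPQ.
  have Px : `|P x| <= `|P x0| + 1.
    rewrite -[P x](subKr (P x0)); apply: le_trans (ler_normB _ _) _.
    by rewrite lerD2l.
  set y := invmx (N x) *m v.
  have vE : v = N x *m y by rewrite /y mulmxA mulmxV// mul1mx.
  have hy : `|y| <= 2 * k0 * `|v|.
    (* A fixed point form of N x y = v: the last term is at most |y| / 2 after applying the inverse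
       and is absorbed on the left. *)
    have yE : y = invmx (N x0) *m (v + (N x0 - N x) *m y).
      by rewrite mulmxBl -vE addrC subrK mulmxA mulVmx// mul1mx.
    have h1 : `|(N x0 - N x) *m y| <= (2 * k0)^-1 * `|y|.
      apply: le_trans (mulmx_norm_le _ _) _; rewrite ler_wpM2r//.
      apply: le_trans (ler_wpM2l (ler0n _ _) hNx) _.
      rewrite invfM mulrCA ler_piMr//; first by rewrite invr_ge0 mulr_ge0// ltW.
      by rewrite ler_pdivrMr ?mul1r ?lerDl// ltr_wpDl.
    have : `|y| <= k0 * (`|v| + (2 * k0)^-1 * `|y|).
      rewrite {1}yE; apply: le_trans (hk0 _) _; rewrite ler_wpM2l ?(ltW k00)//.
      by apply: le_trans (ler_normD _ _) _; rewrite lerD2l.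
    have -> : k0 * (`|v| + (2 * k0)^-1 * `|y|) = k0 * `|v| + `|y| / 2.
      by field; rewrite gt_eqF.
    move=> h2; have : `|y| / 2 <= k0 * `|v| by lra.
    by rewrite ler_pdivrMr// mulrC mulrA.
  apply: le_trans (_ : m%:R * (`|P x0| + 1) * (2 * k0) * `|v| <= _); last first.
    by rewrite ler_wpM2r.
  rewrite /oblique -mulmxA -/y; apply: le_trans (mulmx_norm_le _ _) _.
  rewrite -[leRHS]mulrA; apply: ler_pM => //; last by rewrite ler_wpM2l.
have [k [hk k0]] := filter_ex (filterI H (nbhs_pinfty_gt (num_real 0))).
by exists k.
Unshelve. all: by end_near. Qed.

End ObliqueProjections.

Lemma diff_cancel (R : realType) (V W : normedModType R) (f : V -> W) (g : W -> V) x v :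
  differentiable f x -> differentiable g (f x) -> cancel f g ->
  'd g (f x) ('d f x v) = v.
Proof.
move=> df dg fK; have E := diff_comp df dg.
rewrite (_ : g \o f = id) in E; last by apply/funext => y; exact: fK.
have I : 'd id x = id :> (V -> V) by exact: diff_val.
exact: etrans (esym (congr1 (fun h : V -> V => h v) E)) (congr1 (fun h => h v) I).
Qed.

(** * The dichotomy along an orbit in a hyperbolic attractor *)

Section HyperbolicOrbits.
Context {R : realType} {m : nat}.
Context (F : 'cV[R]_m -> 'cV[R]_m) (L : set 'cV[R]_m).
Hypothesis C1F : C1 F.
Hypothesis bijF : bijective F.
Hypothesis attrL : uniformly_hyperbolic_attractor F L.

Let G := pinv [set: 'cV[R]_m] F.

Let FK : cancel F G.
Proof.
have injF : {in [set: 'cV[R]_m] &, injective F} by move=> x y _ _; exact: bij_inj.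
by move=> x; have := @pinvKV _ _ _ _ F injF x; rewrite inE; apply.
Qed.

Let LF x : L x -> L (F x).
Proof. by move=> Lx; rewrite -(attractor_image attrL); exists x. Qed.

Let LG x : L x -> L (G x).
Proof. by rewrite -{1}(attractor_image attrL) => -[y Ly <-]; rewrite FK. Qed.

(** A point of L is F y with y in L, where the differential is bijective. This gives access by the
    chain rule to the negative iterates in [unstable]. *)
Let diffG x : L x -> differentiable G x.
Proof.
rewrite -{1}(attractor_image attrL) => -[y Ly <-].
by apply: inverse_differentiable => //; exact: (attractor_unit attrL).
Qed.

Let diff_iterG n x : L x -> differentiable (iter n G) x.
Proof.
elim: n x => [|n IH] x Lx; first exact: ex_diff.
rewrite (_ : iter n.+1 G = iter n G \o G); last by apply/funext => y; exact: iterSr.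
by apply: differentiable_comp; [exact: diffG|apply: IH; exact: LG].
Qed.

Lemma differentiable_iter n x : differentiable (iter n F) x.
Proof.
elim: n x => [|n IH] x; first exact: ex_diff.
rewrite (_ : iter n.+1 F = iter n F \o F); last by apply/funext => y; exact: iterSr.
by apply: differentiable_comp; [exact: C1F.1|exact: IH].
Qed.

Lemma diff_iterS n x v : 'd (iter n.+1 F) x v = 'd (iter n F) (F x) ('d F x v).
Proof.
have -> : iter n.+1 F = iter n F \o F by apply/funext => y; exact: iterSr.
have := differentiable_iter n (F x); move: (iter n F) => H dH.
have E := diff_comp (C1F.1 x) dH.
exact: (congr1 (fun h : 'cV[R]_m -> 'cV[R]_m => h v) E).
Qed.

Let L_iter n x : L x -> L (iter n F x).
Proof. by move=> Lx; elim: n => [//|n IH] /=; exact: LF. Qed.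

Let iterK n : cancel (iter n F) (iter n G).
Proof. by elim: n => [//|n IH] x; rewrite iterSr [iter n.+1 F x]iterS FK IH. Qed.

Let diff_iterK n x v : L x ->
  'd (iter n G) (iter n F x) ('d (iter n F) x v) = v.
Proof.
move=> Lx; apply: diff_cancel; last exact: iterK.
  exact: differentiable_iter.
by apply: diff_iterG; exact: L_iter.
Qed.

Section Orbit.
Context (u : nat -> 'cV[R]_m).
Hypothesis uS : forall i, u i.+1 = F (u i).

Lemma orbit_iter n i : u (n + i)%N = iter n F (u i).
Proof. by elim: n => [//|n IH]; rewrite addSn uS IH. Qed.

Lemma diff_iter_cocycle n i v :
  'd (iter n F) (u i) v = cocycle (fun i => jacmx F (u i)) n i *m v.
Proof.
elim: n i v => [|n IH] i v; first by rewrite mul1mx diff_val.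
by rewrite diff_iterS -uS IH jacmxE mulmxA.
Qed.

(** The oblique projections onto the stable and unstable subspaces are bounded on L by compactness,
    commute with the dynamics by invariance of the splitting, and inherit the hyperbolic rates. *)
Lemma attractor_dichotomy : (forall i, L (u i)) ->
  exists Ps Pu : nat -> 'M[R]_m, exists c lam : R,
    0 <= c /\ dichotomy (fun i => jacmx F (u i)) Ps Pu c lam.
Proof.
move=> Lu; pose A i := jacmx F (u i).
have [C [lam [C0 /andP[l0 l1] [Vu [Vs [HV [P [cP HP]] [Q [cQ HQ]]]]] inv]]] :=
  attractor_hyperbolic attrL.
have uA i : A i \in unitmx by apply: jacmx_unit; exact: (attractor_unit attrL).
have VuE x w : L x -> w \in Vu x <-> unstable F C lam x w.
  by move=> /HV[<- _ _ _].
have VsE x w : L x -> w \in Vs x <-> stable F C lam x w.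
  by move=> /HV[_ <- _ _].
have addV x : L x -> (Vu x + Vs x)%VS = fullv by move=> /HV[].
have capV x : L x -> (Vu x :&: Vs x)%VS = 0%VS by move=> /HV[].
have addV' x : L x -> (Vs x + Vu x)%VS = fullv by rewrite addvC; exact: addV.
have capV' x : L x -> (Vs x :&: Vu x)%VS = 0%VS by rewrite capvC; exact: capV.
have cL := attractor_compact attrL.
have uPQ x (Lx : L x) : P x - Q x \in unitmx.
  exact: orthogonal_projectors_sub_unit (HP _ Lx) (HQ _ Lx) (addV _ Lx) (capV _ Lx).
have uQP x (Lx : L x) : Q x - P x \in unitmx.
  exact: orthogonal_projectors_sub_unit (HQ _ Lx) (HP _ Lx) (addV' _ Lx) (capV' _ Lx).
have [ku ku0 hku] := oblique_bounded cL cP cQ uPQ.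
have [ks ks0 hks] := oblique_bounded cL cQ cP uQP.
pose Pu i := oblique (P (u i)) (Q (u i)).
pose Ps i := oblique (Q (u i)) (P (u i)).
have PuV i v : Pu i *m v \in Vu (u i) by rewrite /Pu /oblique -mulmxA (HP _ (Lu i) _).1.
have PsV i v : Ps i *m v \in Vs (u i) by rewrite /Ps /oblique -mulmxA (HQ _ (Lu i) _).1.
have PsPu i : Ps i + Pu i = 1%:M by exact: obliqueD (uQP _ (Lu i)).
have stable_step i v : v \in Vs (u i) <-> A i *m v \in Vs (u i.+1).
  by rewrite !VsE// -jacmxE uS; exact: (inv _ v (Lu i)).2.
have unstable_step i v : v \in Vu (u i) <-> A i *m v \in Vu (u i.+1).
  by rewrite !VuE// -jacmxE uS; exact: (inv _ v (Lu i)).1.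
have unstable_iter n i v : v \in Vu (u i) <-> cocycle A n i *m v \in Vu (u (n + i)%N).
  elim: n => [|n IH]; first by rewrite mul1mx.
  by rewrite cocycleSr -mulmxA IH; exact: unstable_step.
pose N : R := Num.sqrt m%:R.
have N0 : 0 <= N by exact: sqrtr_ge0.
(* Passing between the two norms costs the factor [N]. The summand 1 serves the case n = 0, not
   covered by the inequalities defining [stable] and [unstable]. *)
have norm_of_enorm (a b : 'cV[R]_m) n : enorm a <= C * lam ^+ n * enorm b ->
    `|a| <= (1 + C * N) * lam ^+ n * `|b|.
  move=> h; apply: le_trans (norm_le_enorm a) _; apply: (le_trans h).
  have q0 : 0 <= lam ^+ n by rewrite exprn_ge0// ltW.
  apply: (@le_trans _ _ (C * lam ^+ n * (N * `|b|))).
    by rewrite ler_wpM2l ?enorm_le// mulr_ge0// ltW.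
  rewrite mulrA -[C * _ * N]mulrAC ler_wpM2r// ler_wpM2r// lerDr//.
have dE n i v : 'd (iter n F) (u i) v = cocycle A n i *m v.
  exact: diff_iter_cocycle.
have CN0 : 0 <= C * N by rewrite mulr_ge0// ltW.
have stable_le n i w : w \in Vs (u i) ->
    `|cocycle A n i *m w| <= (1 + C * N) * lam ^+ n * `|w|.
  case: n => [_|n wV]; first by rewrite mul1mx expr0 mulr1 ler_peMl// lerDl.
  have : enorm ('d (iter n.+1 F) (u i) w) <= C * lam ^+ n.+1 * enorm w.
    exact: (VsE _ _ (Lu i)).1 wV (Posz n.+1) isT.
  by rewrite dE => /norm_of_enorm.
(* The unstable estimate is applied at the end point u_{n+i} with [Negz], that is with the n-th
   iterate of the inverse, which brings the propagated vector back to w. *)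
have unstable_le n i w : w \in Vu (u i) ->
    `|w| <= (1 + C * N) * lam ^+ n * `|cocycle A n i *m w|.
  case: n => [_|n wV]; first by rewrite mul1mx expr0 mulr1 ler_peMl// lerDl.
  have : enorm ('d (iter n.+1 G) (u (n.+1 + i)%N) (cocycle A n.+1 i *m w)) <=
      C * lam ^+ n.+1 * enorm (cocycle A n.+1 i *m w).
    exact: (VuE _ _ (Lu _)).1 ((unstable_iter n.+1 i w).1 wV) (Negz n) isT.
  have -> : 'd (iter n.+1 G) (u (n.+1 + i)%N) (cocycle A n.+1 i *m w) = w.
    rewrite -(dE n.+1 i w) (orbit_iter n.+1 i).
    exact: (diff_iterK n.+1 w (Lu i)).
  exact: norm_of_enorm.
have CN1 : 0 <= 1 + C * N by rewrite addr_ge0.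
exists Ps, Pu, ((1 + C * N) * (ks + ku)), lam; split.
  by rewrite mulr_ge0// addr_ge0 ?ltW.
have bound n (w v : 'cV[R]_m) (k : R) : 0 <= k -> k <= ks + ku -> `|w| <= k * `|v| ->
    (1 + C * N) * lam ^+ n * `|w| <= (1 + C * N) * (ks + ku) * lam ^+ n * `|v|.
  move=> k0 kk wv; rewrite [X in _ <= X * _]mulrAC -[leRHS]mulrA.
  have q0 : 0 <= (1 + C * N) * lam ^+ n by rewrite mulr_ge0// exprn_ge0// ltW.
  by apply: ler_wpM2l q0 _ _ _; apply: le_trans wv _; rewrite ler_wpM2r.
split=> //.
- by rewrite (ltW l0).
(* By invariance A_i maps the decomposition of v at u_i to a decomposition of A_i v at u_{i+1},
   which is unique. *)
- move=> i; have H (v : 'cV[R]_m) : A i *m (Ps i *m v) = Ps i.+1 *m (A i *m v).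
    have -> : A i *m v = A i *m (Ps i *m v) + A i *m (Pu i *m v).
      by rewrite -mulmxDr -mulmxDl PsPu mul1mx.
    rewrite /Ps (oblique_unique (HQ _ (Lu _)) (HP _ (Lu _)) (addV' _ _) (capV' _ _))//.
      exact: (stable_step i _).1 (PsV i v).
    exact: (unstable_step i _).1 (PuV i v).
  apply/matrixP => a b; have := congr1 (fun M : 'cV[R]_m => M a 0) (H (delta_mx b 0)).
  by rewrite !mulmxA -!colE !mxE.
- move=> n i v; apply: le_trans (stable_le _ _ _ (PsV _ _)) _.
  by apply: (bound _ _ _ ks); [exact: ltW|rewrite lerDl ltW|exact: hks].
- move=> n i v; set w := icocycle _ _ _ *m _.
  have wE : cocycle A n i *m w = Pu (n + i)%N *m v by rewrite mulmxA icocycleK// mul1mx.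
  have wV : w \in Vu (u i) by apply: (unstable_iter n i w).2; rewrite wE; exact: PuV.
  apply: le_trans (unstable_le n _ _ wV) _; rewrite wE.
  by apply: (bound _ _ _ ku); [exact: ltW|rewrite lerDr ltW|exact: hku].
Qed.

End Orbit.
End HyperbolicOrbits.

(** * Partial derivatives in the state and in the parameter *)

Section PartialDerivatives.
Context {R : realType} {V W : normedModType R}.
Context (g : V * R -> W) (C1g : C1 g).

Let is_diff_left (x : V) (s : R) : is_diff x (fun x => (x, s)) (fun h => (h, 0)).
Proof. exact: (@is_diff_pair _ _ _ _ id id (cst s) 0 x). Qed.

Let is_diff_right (x : V) (s : R) : is_diff s (fun s => (x, s)) (fun h => (0, h)).
Proof. exact: (@is_diff_pair _ _ _ _ (cst x) 0 id id s). Qed.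

Lemma differentiable_left x s : differentiable (fun x => g (x, s)) x.
Proof.
apply: (@differentiable_comp _ _ _ _ (fun x => (x, s)) g); first exact: ex_diff.
exact: C1g.1.
Qed.

Lemma diff_left x s h : 'd (fun x => g (x, s)) x h = 'd g (x, s) (h, 0).
Proof.
rewrite (@diff_comp _ _ _ _ (fun x => (x, s)) g x); last exact: C1g.1.
  by rewrite /= diff_val.
exact: ex_diff.
Qed.

Lemma derive1_right x s : (fun s => g (x, s))^`()%classic s = 'd g (x, s) (0, 1).
Proof.
have d : differentiable (fun s => (x, s)) s by exact: ex_diff.
rewrite derive1E'; last first.
  by apply: (@differentiable_comp _ _ _ _ (fun s => (x, s)) g) => //; exact: C1g.1.
rewrite (@diff_comp _ _ _ _ (fun s => (x, s)) g s)//; last exact: C1g.1.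
by rewrite /= diff_val.
Qed.

Lemma diff_pairE x h s : 'd g (x, 0) (h, s) =
  'd (fun x => g (x, 0)) x h + s *: (fun s => g (x, s))^`()%classic 0.
Proof.
rewrite diff_left derive1_right -linearZ -linearD; congr ('d g _ _).
by congr (_, _) => /=; rewrite ?scaler0 ?addr0// add0r [_ *: _]mulr1.
Qed.

Lemma C1_left s : C1 (fun x => g (x, s)).
Proof.
split=> [x|x e e0]; first exact: differentiable_left.
have cx : (fun x => (x, s)) x' @[x' --> x] --> (x, s).
  by apply: differentiable_continuous; exact: ex_diff.
have := cx _ (C1g.2 (x, s) e e0); rewrite nbhs_simpl /=.
apply: filterS => x' hx' h; rewrite !diff_left; apply: le_trans (hx' _) _.
by rewrite prod_normE /= normr0 maxC max_r.
Qed.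

Lemma compact_left (A : set V) (s : R) :
  compact A -> compact ((fun x : V => (x, s) : V * R) @` A).
Proof.
move=> cA; apply: continuous_compact => //.
by apply: continuous_subspaceT => x; apply: differentiable_continuous; exact: ex_diff.
Qed.

End PartialDerivatives.

(** * Differentiability of a limit from uniform difference quotients *)

Section DerivativeOfLimits.
Context {R : realType}.

(* The bound is uniform in n, so that at a fixed small s the difference
   quotient of a at 0 is within O(e) of all M n with n large: M is Cauchy. *)
Lemma derivable_uniform_quotients (a : R -> R) (M : nat -> R) :
  (forall e, 0 < e -> exists2 d, 0 < d & forall s, 0 < `|s| < d ->
    exists p q : nat -> R, [/\ p @ \oo --> a s, q @ \oo --> a 0 &
      forall n, `|p n - q n - s * M n| <= e * `|s|]) ->
  derivable a 0 1 /\ M @ \oo --> a^`()%classic 0.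
Proof.
move=> H.
have Hs e : 0 < e -> exists2 d, 0 < d & forall s, 0 < `|s| < d ->
    \forall n \near \oo, `|s^-1 * (a s - a 0) - M n| <= e.
  move=> e0; have e20 : 0 < e / 2 by rewrite divr_gt0.
  have [d d0 hd] := H _ e20; exists d => // s sd.
  have s0 : 0 < `|s| by have /andP[] := sd.
  have [p [q [ps q0 pq]]] := hd s sd.
  have pqc : p n - q n @[n --> \oo] --> a s - a 0 by exact: cvgB.
  have es0 : 0 < e / 2 * `|s| by rewrite mulr_gt0.
  near=> n.
  have h1 : `|(a s - a 0) - (p n - q n)| <= e / 2 * `|s|.
    by near: n; exact: (@cvgr_dist_le _ _ _ _ _ _ _ pqc _ es0).
  have -> : s^-1 * (a s - a 0) - M n =
      s^-1 * (((a s - a 0) - (p n - q n)) + (p n - q n - s * M n)).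
    by field; rewrite -normr_gt0.
  rewrite normrM normfV mulrC ler_pdivrMr//.
  apply: le_trans (ler_normD _ _) _; apply: le_trans (lerD h1 (pq n)) _.
  by rewrite -mulrDl -splitr.
have Mc : cvg (M @ \oo).
  apply: cauchy_cvg; apply: cauchy_exP => e e0.
  have e20 : 0 < e / 2 by rewrite divr_gt0.
  have [d d0 hd] := Hs _ e20.
  have sd : 0 < `|d / 2| < d.
    by rewrite gtr0_norm ?divr_gt0// ltr_pdivrMr// ltr_pMr// ltr1n.
  exists ((d / 2)^-1 * (a (d / 2) - a 0)).
  have := hd _ sd; apply: filterS => n; rewrite -ball_normE /= => /le_lt_trans; apply.
  by rewrite ltr_pdivrMr// ltr_pMr// ltr1n.
set l := lim (M @ \oo) in Mc.
have Ml : M @ \oo --> l by move/cvgP: Mc.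
have dl : (fun h => h^-1 *: ((a \o shift 0) (h *: (1 : R)) - a 0)) @ 0^' --> l.
  apply/cvgrPdist_le => e e0.
  have [d d0 hd] := Hs _ e0.
  have : \forall s \near (0 : R)^', 0 < `|s| < d.
    near=> s; apply/andP; split.
      by rewrite normr_gt0; near: s; exact: nbhs_dnbhs_neq.
    near: s; apply: dnbhs0_lt => //.
  apply: filterS => s sd /=.
  rewrite addr0 [s *: 1]mulr1 distrC.
  have h : s^-1 * (a s - a 0) - M n @[n --> \oo] --> s^-1 * (a s - a 0) - l.
    by apply: cvgB => //; exact: cvg_cst.
  apply: (closed_cvg (fun r => r <= e)) (cvg_norm h); first exact: closed_le.
  exact: hd.
split; first by apply/cvg_ex; exists l.
by rewrite derive1E (_ : 'D_1 a 0 = l)//; exact: cvg_lim.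
Unshelve. all: by end_near. Qed.

End DerivativeOfLimits.

(** * Summability of homogeneous solutions *)

Section HomogeneousSolutions.
Context {R : realType} {m : nat}.
Context (A Ps Pu : nat -> 'M[R]_m) (c lam : R).
Hypothesis dich : dichotomy A Ps Pu c lam.
Hypothesis c_ge0 : 0 <= c.

Let dich_commu i : A i *m Pu i = Pu i.+1 *m A i.
Proof.
have PuE j : Pu j = 1%:M - Ps j by rewrite -(dich_sum dich j) addrC addKr.
by rewrite !PuE mulmxBr mulmxBl (dich_comm dich) mulmx1 mul1mx.
Qed.

Let cocycle_comms n i : cocycle A n i *m Ps i = Ps (n + i)%N *m cocycle A n i.
Proof.
elim: n => [|n IH]; first by rewrite mul1mx mulmx1.
by rewrite cocycleSr -mulmxA IH mulmxA (dich_comm dich) -mulmxA.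
Qed.

Let cocycle_commu n i : cocycle A n i *m Pu i = Pu (n + i)%N *m cocycle A n i.
Proof.
elim: n => [|n IH]; first by rewrite mul1mx mulmx1.
by rewrite cocycleSr -mulmxA IH mulmxA dich_commu -mulmxA.
Qed.

(** The stable component of d_i decays from the left end 1 and the unstable one from the right end
    n; both geometric profiles have sums bounded independently of n. *)
Lemma sum_homogeneous_le (d : nat -> 'cV[R]_m) n :
  (forall i, (1 <= i < n)%N -> d i.+1 = A i *m d i) ->
  \sum_(1 <= i < n.+1) `|d i| <= c / (1 - lam) * (`|d 1%N| + `|d n|).
Proof.
move=> dS.
have /andP[l0 l1] := dich_rate dich.
have uA := dich_unit dich.
have dE k i : (1 <= i)%N -> (i + k <= n)%N -> d (k + i)%N = cocycle A k i *m d i.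
  move=> i1; elim: k => [|k IH] ik; first by rewrite mul1mx.
  rewrite addSn dS; last by rewrite (leq_trans i1 (leq_addl _ _)) /= addnC -addnS.
  by rewrite cocycleSr -mulmxA IH// (leq_trans _ ik)// leq_add2l.
have le i : (i < n)%N ->
    `|d i.+1| <= c * lam ^+ i * `|d 1%N| + c * lam ^+ (n - i.+1) * `|d n|.
  move=> i_n; have -> : d i.+1 = Ps i.+1 *m d i.+1 + Pu i.+1 *m d i.+1.
    by rewrite -mulmxDl (dich_sum dich) mul1mx.
  apply: le_trans (ler_normD _ _) _; apply: lerD.
    rewrite (_ : d i.+1 = cocycle A i 1 *m d 1%N); last first.
      by rewrite -dE ?addn1// add1n.
    have := cocycle_comms i 1; rewrite addn1 mulmxA => <-; rewrite -mulmxA.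
    exact: (dich_stable dich).
  have dn : d n = cocycle A (n - i.+1) i.+1 *m d i.+1.
    by rewrite -dE ?subnK ?subnKC.
  have -> : Pu i.+1 *m d i.+1 =
      icocycle A (n - i.+1) i.+1 *m (Pu (n - i.+1 + i.+1)%N *m d n).
    rewrite dn (mulmxA (Pu _)) -cocycle_commu -(mulmxA _ (Pu _)) mulmxA.
    by rewrite cocycleK// mul1mx.
  exact: (dich_unstable dich).
rewrite big_add1 /= big_mkord.
apply: (@le_trans _ _ (\sum_(i < n)
    (c * lam ^+ i * `|d 1%N| + c * lam ^+ (n - i.+1) * `|d n|))).
  by apply: ler_sum => i _; exact: le.
rewrite big_split /= -!mulr_suml -!mulr_sumr mulrDr.
have S : \sum_(i < n) lam ^+ (n - i.+1) = \sum_(i < n) lam ^+ i.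
  rewrite (reindex_inj rev_ord_inj) /=; apply: eq_bigr => i _.
  by rewrite subnSK// subKn// ltnW.
have G : c * \sum_(i < n) lam ^+ i <= c / (1 - lam).
  by rewrite ler_wpM2l// geometric_sum_le// l0.
by rewrite S; apply: lerD; rewrite ler_wpM2r.
Qed.

End HomogeneousSolutions.

(** * First-order shadowing orbits and observables along them *)

Section Shadowing.
Context {R : realType} {m : nat}.
Context (f : 'cV[R]_m * R -> 'cV[R]_m) (L : set 'cV[R]_m) (u : nat -> 'cV[R]_m).
Hypothesis C1f : C1 f.
Hypothesis cptL : compact L.
Hypothesis Lu : forall i, L (u i).
Hypothesis uS : forall i, u i.+1 = f (u i, 0).

Let A i := jacmx (fun x => f (x, 0)) (u i).
Let b i := (fun s : R => f (u i, s))^`()%classic 0.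

Lemma tangent_norm_le (v : 'cV[R]_m) (s B : R) : 1 <= B -> `|v| <= B ->
  `|(s *: v, s)| <= B * `|s|.
Proof.
move=> B1 vB; rewrite prod_normE /= ge_max normrZ mulrC ler_wpM2r//=.
by rewrite ler_peMl.
Qed.

Context (Ps Pu : nat -> 'M[R]_m) (c lam : R).
Hypothesis dich : dichotomy A Ps Pu c lam.
Hypothesis c_ge0 : 0 <= c.
Context (v : nat -> 'cV[R]_m) (B : R).
Hypothesis vB : forall i, `|v i| <= B.
Hypothesis B1 : 1 <= B.
Hypothesis vS : forall i, v i.+1 = A i *m v i + b i.

(** In the ansatz x_i = u_i + s v_i + y_i, the tangent equation for v cancels the first order in s,
    so y solves an eta-Lipschitz perturbation of the linear recursion with data of size eta B |s|,
    and [nonlinear_shadowing] applies. *)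
Lemma shadowing_orbit e : 0 < e ->
  exists2 d, 0 < d & forall s, `|s| < d -> exists x : nat -> 'cV[R]_m,
    (forall i, x i.+1 = f (x i, s)) /\
    forall i, `|x i - u i - s *: v i| <= e * `|s|.
Proof.
move=> e0.
pose K := 2 * c / (1 - lam).
have K0 : 0 <= K.
  by have /andP[_ ?] := dich_rate dich; rewrite !mulr_ge0// invr_ge0 subr_ge0 ltW.
have B0 : 0 < B by exact: lt_le_trans B1.
(* With [eta] below, 2 K eta B <= e1. The cap by e yields the final estimate, and the cap by 1, with
   B >= 1, yields K eta <= 1/2. *)
pose e1 := Num.min e 1.
have e10 : 0 < e1 by rewrite lt_min e0 ltr01.
have e1e : e1 <= e by rewrite ge_min lexx.
have e11 : e1 <= 1 by rewrite ge_min lexx orbT.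
pose eta := e1 / (2 * (K + 1) * B).
have D0 : 0 < 2 * (K + 1) * B by rewrite !mulr_gt0// ltr_wpDl.
have eta0 : 0 < eta by rewrite divr_gt0.
have KetaB : 2 * K * (eta * B) <= e1.
  have -> : 2 * K * (eta * B) = e1 * (K / (K + 1)).
    by rewrite /eta; field; rewrite !gt_eqF// ltr_wpDl.
  apply: ler_piMr; first exact: ltW.
  by rewrite ler_pdivrMr ?ltr_wpDl// mul1r lerDl.
have Keta : K * eta <= 2^-1.
  have h : 2 * K * eta <= 2 * K * (eta * B).
    by apply: ler_wpM2l; [exact: mulr_ge0|rewrite ler_peMr// ltW].
  by have := le_trans h (le_trans KetaB e11); lra.
have [d d0 hd] := strictly_differentiable_compact
  (fun z e' => @C1_strictly_differentiable_mx _ _ _ _ f z e' C1f) C1f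
  (compact_left (s := 0) cptL) eta0.
have hd' i : strictly_differentiable f (u i, 0) eta d by apply: hd; exists (u i).
(* Half of the radius d is for s v_i, the other half for y_i. *)
exists (d / 2 / B) => [|s]; first by rewrite !divr_gt0.
rewrite ltr_pdivlMr// mulrC => sd.
have s_sB : `|s| <= B * `|s| by rewrite ler_peMl.
have svB i : `|s *: v i| <= B * `|s| by rewrite normrZ mulrC ler_wpM2r.
(* Chosen so that x_{i+1} = f(x_i, s) amounts to y_{i+1} = A_i y_i + h_i(y_i). *)
pose h i (y : 'cV[R]_m) := f (u i + s *: v i + y, s) - u i.+1 - s *: v i.+1 - A i *m y.
have near_u i (y : 'cV[R]_m) : `|y| <= d / 2 -> `|(u i + s *: v i + y, s) - (u i, 0)| < d.
  move=> yd; rewrite prod_normE /= gt_max; apply/andP; split.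
    rewrite -[u i + _ + _]addrA [u i + _]addrC addrK; apply: le_lt_trans (ler_normD _ _) _.
    by rewrite (splitr d) ltr_leD// (le_lt_trans (svB i)).
  rewrite subr0; apply: le_lt_trans s_sB (lt_trans sd _).
  by rewrite ltr_pdivrMr// ltr_pMr// ltr1n.
have d20 : 0 <= d / 2 by rewrite divr_ge0// ltW.
have h0 i : `|h i 0| <= eta * B * `|s|.
  have u0 : `|(u i, 0 : R) - (u i, 0)| < d by rewrite subrr normr0.
  have := hd' i _ _ (near_u i 0 _) u0; rewrite normr0 addr0 => /(_ d20).
  have -> : (u i + s *: v i, s) - (u i, 0) = (s *: v i, s).
    by congr (_, _) => /=; rewrite ?subr0// addrC addKr.
  rewrite diff_pairE// -uS jacmxE -/(A i) -/(b i) -scalemxAr -scalerDr -vS => H.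
  rewrite /h mulmx0 subr0 addr0; apply: le_trans H _.
  by rewrite -mulrA ler_wpM2l ?(ltW eta0)// tangent_norm_le.
have hlip i (y y' : 'cV[R]_m) : `|y| <= d / 2 -> `|y'| <= d / 2 ->
    `|h i y - h i y'| <= eta * `|y - y'|.
  move=> yd y'd; have := hd' i _ _ (near_u i y yd) (near_u i y' y'd).
  have -> : (u i + s *: v i + y, s) - (u i + s *: v i + y', s) = (y - y', 0).
    by congr (_, _) => /=; rewrite ?subrr// opprD addrACA subrr add0r.
  rewrite diff_pairE// scale0r addr0 jacmxE -/(A i) prod_normE /= normr0.
  rewrite [Num.max _ 0]max_l//; congr (`|_| <= _).
  rewrite /h mulmxBr.
  by apply/matrixP => k j; rewrite !mxE; ring.
have Kbr : 2 * K * (eta * B * `|s|) <= e1 * `|s|.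
  by rewrite mulrA ler_wpM2r.
have Kbd : 2 * K * (eta * B * `|s|) <= d / 2.
  apply: le_trans Kbr _; apply: le_trans (ltW sd); apply: le_trans s_sB.
  by rewrite ler_piMl.
have [y [yS yb]] := nonlinear_shadowing dich c_ge0 (ltW eta0) Keta Kbd h0 hlip.
exists (fun i => u i + s *: v i + y i); split=> i.
  rewrite yS /h.
  by apply/matrixP => k j; rewrite !mxE; ring.
have -> : u i + s *: v i + y i - u i - s *: v i = y i.
  by rewrite -addrA -opprD addrC addKr.
apply: le_trans (yb i) _; apply: le_trans Kbr _.
by rewrite ler_wpM2r.
Qed.

(** J is expanded at (u_i, 0): the remainder is small because the displacement is at most (B + 1)
    |s|, and the shadowing error enters through the differential of J, bounded on L. *)
Lemma shadowing_observable (J : 'cV[R]_m * R -> R) e : C1 J -> 0 < e ->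
  exists2 d, 0 < d & forall s, `|s| < d -> exists x : nat -> 'cV[R]_m,
    (forall i, x i.+1 = f (x i, s)) /\
    forall i, `|J (x i, s) - J (u i, 0) - s * 'd J (u i, 0) (v i, 1)| <= e * `|s|.
Proof.
move=> C1J e0.
have B0 : 0 < B by exact: lt_le_trans B1.
have cL := compact_left (s := 0 : R) cptL.
have [k k0 hk] := diff_bounded_compact C1J cL.
pose e1 := e / (2 * (B + 1)).
have B10 : 0 < B + 1 by rewrite addr_gt0.
have e10 : 0 < e1 by rewrite divr_gt0// mulr_gt0.
have [d d0 hd] := strictly_differentiable_compact
  (fun z e' => @C1_strictly_differentiable_real _ _ J z e' C1J) C1J cL e10.
(* The bound 1 keeps the displacement below (B + 1) |s|; the other one makes the shadowing error
   contribute at most e |s| / 2. *)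
pose e2 := Num.min 1 (e / (2 * k)).
have e20 : 0 < e2 by rewrite lt_min ltr01 divr_gt0// mulr_gt0.
have e21 : e2 <= 1 by rewrite ge_min lexx.
have e2k : k * e2 <= e / 2.
  have : e2 <= e / (2 * k) by rewrite ge_min lexx orbT.
  move=> /(ler_wpM2l (ltW k0)) /le_trans; apply.
  by rewrite le_eqVlt; apply/orP; left; apply/eqP; field; rewrite gt_eqF.
have [d' d'0 hx] := shadowing_orbit e20.
exists (Num.min d' (d / (B + 1))) => [|s]; first by rewrite lt_min d'0 divr_gt0.
rewrite lt_min ltr_pdivlMr// => /andP[sd' sd].
have [x [xS xb]] := hx s sd'; exists x; split=> // i.
have Lz : ((fun y : 'cV[R]_m => (y, 0 : R)) @` L) (u i, 0) by exists (u i).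
have zE : (x i, s) - (u i, 0) = (x i - u i, s) :> 'cV[R]_m * R.
  by congr (_, _) => /=; rewrite subr0.
have xu : `|(x i - u i, s)| <= (B + 1) * `|s|.
  rewrite prod_normE /= ge_max; apply/andP; split; last first.
    by rewrite ler_peMl// lerDr ltW.
  rewrite -(subrK (s *: v i) (x i - u i)); apply: le_trans (ler_normD _ _) _.
  rewrite addrC mulrDl mul1r; apply: lerD.
    by rewrite normrZ mulrC ler_wpM2r.
  by apply: le_trans (xb i) _; rewrite ler_piMl.
have h1 : `|J (x i, s) - J (u i, 0) - 'd J (u i, 0) (x i - u i, s)| <= e / 2 * `|s|.
  have zd : `|(x i, s) - (u i, 0)| < d by rewrite zE (le_lt_trans xu)// mulrC.
  have u0 : `|(u i, 0 : R) - (u i, 0)| < d by rewrite subrr normr0.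
  have := hd _ Lz _ _ zd u0; rewrite zE => /le_trans; apply.
  apply: (@le_trans _ _ (e1 * ((B + 1) * `|s|))); first by rewrite ler_wpM2l// ltW.
  by rewrite le_eqVlt /e1; apply/orP; left; apply/eqP; field; rewrite gt_eqF.
have h2 : `|'d J (u i, 0) (x i - u i - s *: v i, 0)| <= e / 2 * `|s|.
  apply: le_trans (hk _ Lz _) _; rewrite prod_normE /= normr0 [Num.max _ 0]max_l//.
  apply: le_trans (ler_wpM2l (ltW k0) (xb i)) _.
  by rewrite mulrA ler_wpM2r.
have -> : J (x i, s) - J (u i, 0) - s * 'd J (u i, 0) (v i, 1) =
    (J (x i, s) - J (u i, 0) - 'd J (u i, 0) (x i - u i, s)) +
    'd J (u i, 0) (x i - u i - s *: v i, 0).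
  have -> : (x i - u i - s *: v i, 0) = (x i - u i, s) - s *: (v i, 1) :> 'cV[R]_m * R.
    by congr (_, _) => /=; rewrite [s *: 1]mulr1 subrr.
  by rewrite linearB [X in _ = _ + (_ - X)]linearZ /= addrA subrK.
apply: le_trans (ler_normD _ _) _; apply: le_trans (lerD h1 h2) _.
by rewrite -mulrDl -splitr.
Qed.

End Shadowing.

(** * Deviation of the least squares solution from the bounded tangent solution *)

Section LeastSquares.
Context {R : realType} {m : nat}.
Context (f : 'cV[R]_m * R -> 'cV[R]_m) (u : int -> 'cV[R]_m).

Let A (i : nat) := jacmx (fun x => f (x, 0)) (u i).
Let b (i : nat) := (fun s : R => f (u i, s))^`()%classic 0.

Context (Ps Pu : nat -> 'M[R]_m) (c lam : R).
Hypothesis dich : dichotomy A Ps Pu c lam.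
Hypothesis c_ge0 : 0 <= c.
Context (w : nat -> 'cV[R]_m) (B : R).
Hypothesis wB : forall i, `|w i| <= B.
Hypothesis wS : forall i, w i.+1 = A i *m w i + b i.

(* Minimality against the competitor w bounds the end points of v by
   O(sqrt n), and the dichotomy makes v - w decay away from the end points. *)
Lemma lss_deviation_le n v : (1 <= n)%N -> lss_solution f u n v ->
  \sum_(1 <= i < n.+1) `|v i - w i| <=
  c / (1 - lam) * (2 * (1 + Num.sqrt m%:R) * B) * Num.sqrt n%:R.
Proof.
move=> n1 [vc vmin].
have B0 : 0 <= B by apply: le_trans (wB 0%N).
have wc : lss_constraint f u n w by move=> i _; rewrite wS jacmxE.
have sum_w : \sum_(1 <= i < n.+1) dotp (w i) (w i) <= n%:R * (m%:R * B ^+ 2).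
  rewrite big_add1 /= big_mkord mulr_natl -[X in _ *+ X]card_ord -sumr_const.
  apply: ler_sum => i _; apply: le_trans (dotp_le _) _.
  by rewrite ler_wpM2l// lerXn2r ?nnegrE.
have sum_v : \sum_(1 <= i < n.+1) dotp (v i) (v i) <= n%:R * (m%:R * B ^+ 2).
  apply: le_trans sum_w; have := vmin w wc.
  by rewrite ler_pM2l// invr_gt0.
pose S : R := Num.sqrt n%:R.
have S1 : 1 <= S by rewrite -sqrtr1 ler_sqrt ?ler0n// ler1n.
have vle j : (1 <= j <= n)%N -> `|v j| <= S * (Num.sqrt m%:R * B).
  move=> jn; apply: le_trans (norm_le_enorm _) _.
  have -> : S * (Num.sqrt m%:R * B) = Num.sqrt (n%:R * (m%:R * B ^+ 2)).
    by rewrite sqrtrM ?ler0n// sqrtrM ?ler0n// sqrtr_sqr (ger0_norm B0).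
  rewrite ler_sqrt; last by rewrite !mulr_ge0// sqr_ge0.
  apply: le_trans sum_v.
  rewrite (bigD1_seq j) ?iota_uniq ?mem_index_iota//= lerDl.
  by apply: sumr_ge0 => i _; exact: dotp_ge0.
have dS i : (1 <= i < n)%N -> v i.+1 - w i.+1 = A i *m (v i - w i).
  by move=> /vc ->; rewrite wS jacmxE mulmxBr opprD addrACA subrr addr0.
apply: le_trans (sum_homogeneous_le dich c_ge0 dS) _.
have /andP[_ l1] := dich_rate dich.
have cl0 : 0 <= c / (1 - lam) by rewrite divr_ge0// subr_ge0 ltW.
rewrite -[leRHS]mulrA; apply: ler_wpM2l cl0 _ _ _.
have dle j : (1 <= j <= n)%N -> `|v j - w j| <= (1 + Num.sqrt m%:R) * B * S.
  move=> jn; apply: le_trans (ler_normB _ _) _.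
  apply: le_trans (lerD (vle j jn) (wB j)) _.
  have : B <= B * S by rewrite ler_peMr.
  by rewrite !mulrDl mul1r; lra.
apply: le_trans (lerD (dle 1%N _) (dle n _)) _; rewrite ?n1 ?leqnn//.
by rewrite -/S le_eqVlt; apply/orP; left; apply/eqP; ring.
Qed.

End LeastSquares.

(** * Passage to time averages *)

Lemma mean_norm_le (R : realType) (E : nat -> R) (e : R) n : 0 <= e ->
  (forall i, `|E i| <= e) -> `|n%:R^-1 * \sum_(1 <= i < n.+1) E i| <= e.
Proof.
(* The empty average is 0, since the inverse of 0 is 0. *)
move=> e0 Ee; have [->|n0] := posnP n; first by rewrite invr0 mul0r normr0.
have n0' : (0 : R) < n%:R by rewrite ltr0n.
rewrite normrM ger0_norm ?invr_ge0 ?ler0n// mulrC ler_pdivrMr//.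
apply: le_trans (ler_norm_sum _ _ _) _.
rewrite big_add1 /= big_mkord mulr_natr -[X in _ *+ X]card_ord -sumr_const.
by apply: ler_sum => i _; exact: Ee.
Qed.

Lemma cvg_invn_sqrt (R : realType) (C : R) : 0 <= C ->
  n%:R^-1 * (C * Num.sqrt n%:R) @[n --> \oo] --> (0 : R).
Proof.
move=> C0; apply/cvgrPdist_le => e e0; near=> n.
have n0 : (0 : R) < n%:R by rewrite ltr0n; near: n; exact: nbhs_infty_gt.
have hn : (C / e) ^+ 2 <= n%:R by near: n; exact: nbhs_infty_ger.
have S0 : 0 <= Num.sqrt n%:R :> R by exact: sqrtr_ge0.
have hS : C <= e * Num.sqrt n%:R.
  have Ce0 : 0 <= C / e by rewrite divr_ge0// ltW.
  by rewrite mulrC -ler_pdivrMr// -(ger0_norm Ce0) -sqrtr_sqr ler_sqrt// ltW.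
have P0 : 0 <= n%:R^-1 * (C * Num.sqrt n%:R).
  by apply: mulr_ge0; [rewrite invr_ge0 ltW|exact: mulr_ge0].
rewrite sub0r normrN (ger0_norm P0).
rewrite mulrC ler_pdivrMr// -[X in _ <= _ * X]sqr_sqrtr ?(ltW n0)// expr2 mulrA.
by rewrite ler_wpM2r.
Unshelve. all: by end_near. Qed.

Theorem mainTheorem1 (R : realType) (m : nat)
  (f : 'cV[R]_m * R -> 'cV[R]_m) (J : 'cV[R]_m * R -> R)
  (L : set 'cV[R]_m) (avgJ : R -> R)
  (u : int -> 'cV[R]_m) (v : nat -> nat -> 'cV[R]_m)
  (f_C1 : C1 f)
  (f0_bij : bijective (fun x => f (x, 0)))
  (L_attractor : uniformly_hyperbolic_attractor (fun x => f (x, 0)) L)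
  (J_C1 : C1 J)
  (avgJ_def : forall s : R, is_time_average f J s (avgJ s))
  (u_in_L : forall i : int, L (u i))
  (u_orbit : forall i : int, u (i + 1) = f (u i, 0))
  (v_lss : forall n : nat, (1 <= n)%N -> lss_solution f u n (v n)) :
  derivable avgJ 0 1 /\
  (fun n : nat => n%:R^-1 * \sum_(1 <= i < n.+1)
     ('d (fun x => J (x, 0)) (u i) (v n i) + (fun s : R => J (u i, s))^`()%classic 0))
    @ \oo --> avgJ^`()%classic 0.
Proof.
pose F x := f (x, 0); pose U (i : nat) := u i.
have US i : U i.+1 = f (U i, 0).
  by rewrite /U -u_orbit; congr u; rewrite -addn1 PoszD.
have LU i : L (U i) by exact: u_in_L.
have C1F : C1 F by exact: C1_left.
have cL := attractor_compact L_attractor.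
have cL0 := compact_left (s := 0 : R) cL.
have LU0 i : ((fun x => (x, 0 : R)) @` L) (U i, 0) by exists (U i).
have [Ps [Pu [c [lam [c0 dich]]]]] :=
  attractor_dichotomy C1F f0_bij L_attractor (u := U) US LU.
have [k k0 hk] := diff_bounded_compact f_C1 cL0.
have bk i : `|(fun s : R => f (U i, s))^`()%classic 0| <= k.
  rewrite derive1_right//; apply: le_trans (hk _ (LU0 i) _) _.
  by rewrite prod_normE /= normr0 normr1 max_r ?mulr1.
have [w [wS wB]] := linear_shadowing dich c0 bk.
set B0 := 2 * c / (1 - lam) * k in wB.
pose B := `|B0| + 1.
have B1 : 1 <= B by rewrite lerDr.
(* The bound is raised to [B] >= 1 because the norm of the tangent vector (s w_i, s) also sees the
   component s. *)
have {}wB i : `|w i| <= B.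
  by apply: le_trans (wB i) _; apply: le_trans (ler_norm _) _; rewrite lerDl.
pose M (n : nat) : R := n%:R^-1 * \sum_(1 <= i < n.+1) 'd J (U i, 0) (w i, 1).
have iterE s (x : nat -> 'cV[R]_m) (xS : forall i, x i.+1 = f (x i, s)) i :
    iter i (fun y => f (y, s)) (x 0%N) = x i.
  by rewrite -(@orbit_iter _ _ (fun y => f (y, s)) x xS i 0) addn0.
have [dJ Mc] : derivable avgJ 0 1 /\ M @ \oo --> avgJ^`()%classic 0.
  apply: derivable_uniform_quotients => e e0.
  have [d d0 hd] := shadowing_observable f_C1 cL LU US dich c0 wB B1 wS J_C1 e0.
  exists d => // s /andP[_ sd]; have [x [xS xJ]] := hd s sd.
  exists (fun n => n%:R^-1 * \sum_(1 <= i < n.+1) J (x i, s)).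
  exists (fun n => n%:R^-1 * \sum_(1 <= i < n.+1) J (U i, 0)); split.
  (* Independence of the initial state enters here: the average at s is taken along the shadowing
     orbit, the one at 0 along (u_i). *)
  - have := avgJ_def s (x 0%N).
    by under eq_fun do under eq_bigr do rewrite (iterE s x xS).
  - have := avgJ_def 0 (U 0%N).
    by under eq_fun do under eq_bigr do rewrite (iterE 0 U US).
  - move=> n; rewrite /M mulrCA -mulrBr -mulrBr mulr_sumr -!sumrB.
    by apply: mean_norm_le => //; rewrite mulr_ge0// ltW.
split; first exact: dJ.
have [kJ kJ0 hkJ] := diff_bounded_compact J_C1 cL0.
pose T n : R := n%:R^-1 * \sum_(1 <= i < n.+1) 'd J (U i, 0) (v n i, 1).
have -> : (fun n : nat => n%:R^-1 * \sum_(1 <= i < n.+1)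
     ('d (fun x => J (x, 0)) (u i) (v n i) + (fun s : R => J (u i, s))^`()%classic 0)) = T.
  apply/funext => n; congr (_ * _); apply: eq_bigr => i _.
  by rewrite diff_pairE// scale1r.
pose C := kJ * (c / (1 - lam) * (2 * (1 + Num.sqrt m%:R) * B)).
have C0 : 0 <= C.
  have /andP[_ l1] := dich_rate dich.
  have B0' : 0 <= B by apply: le_trans B1.
  have s0 : 0 <= 1 + Num.sqrt m%:R :> R by rewrite addr_ge0// sqrtr_ge0.
  by rewrite /C !mulr_ge0// ?invr_ge0 ?subr_ge0 ltW.
(* The parameter components of (w_i, 1) and (v_i, 1) cancel, so the averages differ by at most [kJ]
   times the mean deviation of v from w, which is O(1 / sqrt n). *)
have TM n : (1 <= n)%N -> `|M n - T n| <= n%:R^-1 * (C * Num.sqrt n%:R).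
  move=> n1; rewrite /M /T -mulrBr -sumrB normrM ger0_norm ?invr_ge0 ?ler0n//.
  rewrite ler_wpM2l ?invr_ge0 ?ler0n//.
  apply: le_trans (ler_norm_sum _ _ _) _.
  apply: (@le_trans _ _ (kJ * \sum_(1 <= i < n.+1) `|v n i - w i|)).
    rewrite mulr_sumr; apply: ler_sum => i _; rewrite -linearB.
    have -> : (w i, 1) - (v n i, 1) = (w i - v n i, 0) :> 'cV[R]_m * R.
      by congr (_, _) => /=; rewrite subrr.
    apply: le_trans (hkJ _ (LU0 i) _) _.
    by rewrite prod_normE /= normr0 max_l// distrC.
  rewrite -mulrA ler_wpM2l ?(ltW kJ0)//.
  exact: (lss_deviation_le (f := f) (u := u) dich c0 wB wS n1 (v_lss n n1)).
rewrite (_ : T = fun n => M n - (M n - T n)); last first.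
  by apply/funext => n; rewrite subKr.
rewrite -[X in _ --> X]subr0; apply: cvgB => //.
apply/cvgr0Pnorm_le => e e0; near=> n.
have n1 : (1 <= n)%N by near: n; exact: nbhs_infty_gt.
apply: le_trans (TM n n1) _; apply: le_trans (ler_norm _) _.
by near: n; move: e e0; apply/cvgr0Pnorm_le; exact: cvg_invn_sqrt.
Unshelve. all: by end_near. Qed.
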